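(* Let $G$ be a locally compact abelian group, let $1\le p,q,r<\infty$, let $\vartheta_1,\vartheta_2$ be Beurling weights on $G$ and $\vartheta$ a Beurling weight on the dual group $\widehat G$. Then $A^{p,1,q,r}_{\vartheta_1,\vartheta}(G)$ is continuously embedded in $A^{p,1,q,r}_{\vartheta_2,\vartheta}(G)$ if and only if $\vartheta_2\prec\vartheta_1$.
   Context: ''$X$ is continuously embedded in $Y$'' means $X\subset Y$ and there is $c>0$ with $\|f\|_Y\le c\|f\|_X$ for all $f\in X$. $\vartheta_2\prec\vartheta_1$ means there is $C>0$ with $\vartheta_2(x)\le C\vartheta_1(x)$ for all $x\in G$. A Beurling weight on a locally compact abelian group $G$ is a measurable, locally integrable function $\vartheta:G\to(0,\infty)$ with $\vartheta(x)\ge 1$ and $\vartheta(x+y)\le\vartheta(x)\vartheta(y)$ for all $x,y\in G$. Amalgam spaces: by the structure theorem write $G=\mathbb R^a\times G_1$ with $a\ge 0$ an integer and $G_1$ a locally compact abelian group containing an open compact subgroup $H$. Put $I=[0,1)^a\times H$, $J=\mathbb Z^a\times T$ with $T$ a transversal of $H$ in $G_1$ (so $G_1=\bigcup_{t\in T}(t+H)$ is a coset decomposition), and $I_\alpha=\alpha+I$ for $\alpha\in J$; $G$ is the disjoint union of the $I_\alpha$, and Haar measure is normalized so that $I$ has measure $1$. For $1\le p,q<\infty$ let $\|f\|_{pq}=\big(\sum_{\alpha\in J}\|f\|_{L^p(I_\alpha)}^q\big)^{1/q}$. For a weight $\vartheta$, $(L^p_\vartheta,\ell^q)$ is the space of $f\in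 L^p_{loc}(G)$ (mod a.e. equality) with $\|f\|_{pq,\vartheta}:=\|f\vartheta\|_{pq}<\infty$. The same definitions are used on $\widehat G$. $\widehat f(\gamma)=\int_G f(x)\overline{\langle x,\gamma\rangle}\,dx$ is the Fourier transform. For Beurling weights $\nu$ on $G$ and $\omega$ on $\widehat G$, define $A^{p,1,q,r}_{\nu,\omega}(G)=\{f\in(L^p_{\nu},\ell^1):\widehat f\in(L^q_{\omega},\ell^r)\}$, the second space being taken on $\widehat G$, with norm $\|f\|^{p,1,q,r}_{\nu,\omega}=\|f\|_{p1,\nu}+\|\widehat f\|_{qr,\omega}$. *)

(* Defs.v *)
From HB Require Import structures.
From mathcomp Require Import all_boot all_order all_algebra.
From mathcomp Require Import all_classical all_reals all_analysis.
From mathcomp Require Import complex.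

Set Implicit Arguments.
Unset Strict Implicit.
Unset Printing Implicit Defensive.

Import Order.TTheory GRing.Theory Num.Theory.
Import numFieldNormedType.Exports.

Local Open Scope classical_set_scope.
Local Open Scope ring_scope.

(* The dual group, written additively, with the compact-open topology.  The
   regular algebra [R[i]^o] carries the usual topology of the complex plane. *)
Record character (R : realType) (G : topologicalZmodType) := Character {
  character_fun :> G -> R[i];
  character_norm : forall x, `|character_fun x| = 1;
  characterD : forall x y,
    character_fun (x + y) = character_fun x * character_fun y;
  character_continuous : continuous (character_fun : G -> R[i]^o) }.

Section character_group.
Context {R : realType} {G : topologicalZmodType}.
Local Notation dual := (character R G).
Implicit Types chi psi : dual.

HB.instance Definition _ := gen_eqMixin dual.
HB.instance Definition _ := gen_choiceMixin dual.

Lemma character_eqP chi psi : (forall x, chi x = psi x) -> chi = psi.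
Proof.
move=> /funext; case: chi psi => [f n m c] [g n' m' c'] /= fg.
by subst g; congr Character; exact: Prop_irrelevance.
Qed.

Lemma conjc_continuous : continuous (@conjc R : R[i]^o -> R[i]^o).
Proof.
move=> x; apply/(@cvgrPdist_lt R[i] R[i]^o R[i]^o (nbhs x) _ _ _) => e e0.
near=> y; rewrite -rmorphB /= normcJ.
by near: y; apply: (@cvgr_dist_lt R[i] R[i]^o _ (nbhs x) _ id).
Unshelve. all: by end_near. Qed.

Lemma character1_norm (x : G) : `|1 : R[i]| = 1.
Proof. exact: normr1. Qed.
Lemma character1_D (x y : G) : 1 = 1 * 1 :> R[i].
Proof. by rewrite mulr1. Qed.
Definition character1 : dual :=
  Character character1_norm character1_D (@cst_continuous G R[i]^o 1).

Lemma characterM_norm chi psi x : `|chi x * psi x| = 1.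
Proof. by rewrite normrM !character_norm mulr1. Qed.
Lemma characterM_D chi psi x y :
  chi (x + y) * psi (x + y) = chi x * psi x * (chi y * psi y).
Proof. by rewrite !characterD mulrACA. Qed.
Lemma characterM_continuous chi psi :
  continuous ((fun x => chi x * psi x) : G -> R[i]^o).
Proof.
move=> x; apply: (@cvgM R[i] G (nbhs x) _ 
    (chi : G -> R[i]^o) (psi : G -> R[i]^o) (chi x) (psi x)).
  exact: character_continuous.
exact: character_continuous.
Qed.
Definition characterM chi psi : dual := Character
  (characterM_norm chi psi) (characterM_D chi psi)
  (@characterM_continuous chi psi).

Lemma characterV_norm chi x : `|(chi x)^*%C| = 1.
Proof. by rewrite normcJ character_norm. Qed.
Lemma characterV_D chi x y : (chi (x + y))^*%C = (chi x)^*%C * (chi y)^*%C.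
Proof. by rewrite characterD rmorphM. Qed.
Lemma characterV_continuous chi :
  continuous ((fun x => (chi x)^*%C) : G -> R[i]^o).
Proof.
move=> x; apply: (@continuous_comp G R[i]^o R[i]^o chi (@conjc R)).
  exact: character_continuous.
exact: conjc_continuous.
Qed.
Definition characterV chi : dual := Character
  (characterV_norm chi) (characterV_D chi) (@characterV_continuous chi).

Lemma characterMA : associative characterM.
Proof. by move=> a b c; apply: character_eqP => x /=; rewrite mulrA. Qed.
Lemma characterMC : commutative characterM.
Proof. by move=> a b; apply: character_eqP => x /=; rewrite mulrC. Qed.
Lemma character1M : left_id character1 characterM.
Proof. by move=> a; apply: character_eqP => x /=; rewrite mul1r. Qed.
Lemma characterVM : left_inverse character1 characterV characterM.
Proof.
move=> a; apply: character_eqP => x /=.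
by rewrite mulrC -sqr_normc character_norm expr1n.
Qed.

HB.instance Definition _ := GRing.isZmodule.Build dual
  characterMA characterMC character1M characterVM.

HB.instance Definition _ := Topological.copy dual
  (initial_topology (@character_fun R G : dual -> {compact-open, G -> R[i]^o})).

Lemma nbhs_character (a : dual) (K : set G) (e : R[i]) : compact K -> 0 < e ->
  nbhs a [set chi : dual | forall y, K y -> `|a y - chi y| < e].
Proof.
move=> cK e0; pose ev : dual -> {compact-open, G -> R[i]^o} := @character_fun R G.
have cev : {compact-open, ev @ nbhs a --> ev a}.
  exact: (@initial_continuous dual {compact-open, G -> R[i]^o}).
have /fam_cvgP cK' : {family compact, ev @ nbhs a --> (ev a : G -> R[i]^o)}.
  apply/(@compact_open_fam_compactP G R[i]^o) => //.
  exact: character_continuous.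
move: (cK' K cK) => /(_ [set h | forall y, K y -> `|a y - h y| < e]) cN.
apply: cN.
apply/uniform_nbhs; exists [set z : R[i]^o * R[i]^o | ball z.1 e z.2].
split; last by move=> h /= hK y Ky; exact: hK.
by rewrite -entourage_ballE; exists e.
Qed.

Lemma character_sub_continuous : continuous (fun x : dual * dual => x.1 - x.2).
Proof.
move=> [a b]; set F := nbhs (a, b); pose ev : dual -> {compact-open, G -> R[i]^o} := @character_fun R G.
suff cF : {compact-open, (fun x : dual * dual => ev (x.1 - x.2)) @ F --> ev (a - b)}.
  move=> U [_ [[C oC <-] Cab] CU]; apply: filterS CU _.
  by apply: cF; exact: open_nbhs_nbhs.
apply/(@compact_open_fam_compactP G R[i]^o); first exact: character_continuous.
apply/fam_cvgP => K cK P /uniform_nbhs [E [entE EP]]; apply: (filterS EP).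
move: entE; rewrite -entourage_ballE => -[e /= e0 eE].
have e20 : 0 < e / 2 by rewrite divr_gt0.
exists ([set chi : dual | forall y, K y -> `|a y - chi y| < e / 2],
        [set chi : dual | forall y, K y -> `|b y - chi y| < e / 2]).
  by split; exact: nbhs_character.
move=> [chi psi] /= [achi bpsi] y Ky; apply: eE => /=.
rewrite /ball /= /ball_.
have -> : a y * (b y)^*%C - chi y * (psi y)^*%C =
          (a y - chi y) * (b y)^*%C + chi y * (b y - psi y)^*%C.
  by rewrite rmorphB /= mulrBl mulrBr addrA subrK.
apply: (le_lt_trans (ler_normD _ _)).
rewrite !normrM !normcJ !character_norm mulr1 mul1r [ltRHS](splitr e).
by rewrite ltrD ?achi ?bpsi.
Qed.

HB.instance Definition _ :=
  PreTopologicalNmodule_isTopologicalZmodule.Build dual character_sub_continuous.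

End character_group.

(* The Borel sets of [G]; the alias provides the base point that
   [g_sigma_algebraType] requires. *)
Definition pointed_group (G : topologicalZmodType) : Type := G.
HB.instance Definition _ (G : topologicalZmodType) := Choice.on (pointed_group G).
HB.instance Definition _ (G : topologicalZmodType) :=
  isPointed.Build (pointed_group G) (0 : G).
Definition borel (G : topologicalZmodType) :=
  g_sigma_algebraType (@open G : set (set (pointed_group G))).

(* Haar measure as a Radon measure that is inner regular on every Borel set.
   If [G] is not sigma-compact, this is the normalization for which "null" means
   "locally null"; with the outer regular one, functions vanishing locally
   almost everywhere need not be integrable. *)
Record haar_measure (R : realType) (G : topologicalZmodType)
    (mu : {measure set (borel G) -> \bar R}) : Prop := {
  haar_neq0 : mu [set: G] != 0%E;
  haar_translation : forall (x : G) (A : set (borel G)), measurable A ->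
    mu [set x + a | a in (A : set G)] = mu A;
  haar_compact : forall K : set G, compact K -> (mu K < +oo)%E;
  haar_inner_regular : forall A : set (borel G), measurable A ->
    mu A = ereal_sup [set mu K | K in [set K : set G | compact K /\ K `<=` A]] }.

(* A presentation of [G] as R^a x G_1, with a compact open subgroup H of the
   Hausdorff locally compact group G_1 and a transversal of H in G_1: [dec_iso]
   is an isomorphism of topological groups with inverse [dec_inv]. *)
Record decomposition (R : realType) (G : topologicalZmodType) := Decomposition {
  dec_dim : nat;
  dec_factor : topologicalZmodType;
  dec_factor_hausdorff : hausdorff_space dec_factor;
  dec_factor_locally_compact : locally_compact [set: dec_factor];
  dec_iso : G -> 'rV[R]_dec_dim * dec_factor;
  dec_inv : 'rV[R]_dec_dim * dec_factor -> G;
  dec_isoD : forall x y, dec_iso (x + y) = dec_iso x + dec_iso y;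
  dec_isoK : cancel dec_iso dec_inv;
  dec_invK : cancel dec_inv dec_iso;
  dec_iso_continuous : continuous dec_iso;
  dec_inv_continuous : continuous dec_inv;
  dec_subgroup : set dec_factor;
  dec_subgroup0 : dec_subgroup 0;
  dec_subgroupB : forall x y,
    dec_subgroup x -> dec_subgroup y -> dec_subgroup (x - y);
  dec_subgroup_open : open dec_subgroup;
  dec_subgroup_compact : compact dec_subgroup;
  dec_transversal : set dec_factor;
  dec_transversalP : forall x,
    exists! t, dec_transversal t /\ dec_subgroup (x - t) }.

Arguments dec_iso {R G} d _.
Arguments dec_subgroup {R G} d _.
Arguments dec_transversal {R G} d _.

Section amalgam.
Context {R : realType} {G : topologicalZmodType} (D : decomposition R G).
Variable mu : {measure set (borel G) -> \bar R}.

(* J = Z^a x T and I = [0, 1)^a x H live in R^a x G_1; only the cells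
   alpha + I are pulled back to [G]. *)
Definition dec_index :=
  [set alpha : 'rV[R]_(dec_dim D) * dec_factor D |
    (forall i, alpha.1 ord0 i \is a Num.int) /\ dec_transversal D alpha.2].

Definition dec_unit :=
  [set x : 'rV[R]_(dec_dim D) * dec_factor D |
    (forall i, 0 <= x.1 ord0 i < 1) /\ dec_subgroup D x.2].

Definition dec_cell (alpha : 'rV[R]_(dec_dim D) * dec_factor D) : set (borel G) :=
  [set x : G | dec_unit (dec_iso D x - alpha)].

Definition normalized_haar : Prop := haar_measure mu /\ mu (dec_cell 0) = 1%E.

Definition modulus (f : G -> R[i]) (x : borel G) : R :=
  ComplexField.Normc.normc (f x).

Definition Lp_norm_on (p : R) (A : set (borel G)) (f : G -> R[i]) : \bar R :=
  ((\int[mu]_(x in A) (modulus f x `^ p)%:E) `^ p^-1)%E.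

Definition amalgam_norm (p q : R) (f : G -> R[i]) : \bar R :=
  ((\esum_(alpha in dec_index) Lp_norm_on p (dec_cell alpha) f `^ q) `^ q^-1)%E.

Definition complex_measurable (f : G -> R[i]) : Prop :=
  measurable_fun [set: borel G] (fun x : borel G => complex.Re (f x)) /\
  measurable_fun [set: borel G] (fun x : borel G => complex.Im (f x)).

Definition Lp_loc (p : R) : set (G -> R[i]) :=
  [set f | complex_measurable f /\ forall K : set G, compact K ->
     (\int[mu]_(x in (K : set (borel G))) (modulus f x `^ p)%:E < +oo)%E].

Definition weighted_amalgam_norm (w : G -> R) (p q : R) (f : G -> R[i]) : \bar R :=
  amalgam_norm p q (fun x => f x * (w x)%:C%C).

(* Elements are represented by functions; membership and the norm depend only
   on the almost everywhere class. *)
Definition weighted_amalgam (w : G -> R) (p q : R) : set (G -> R[i]) :=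
  [set f | Lp_loc p f /\ (weighted_amalgam_norm w p q f < +oo)%E].

Definition beurling_weight (w : G -> R) : Prop :=
  [/\ measurable_fun [set: borel G] (w : borel G -> R),
      forall K : set G, compact K ->
        (\int[mu]_(x in (K : set (borel G))) (w x)%:E < +oo)%E,
      forall x, 1 <= w x &
      forall x y, w (x + y) <= w x * w y].

Definition fourier (f : G -> R[i]) (chi : character R G) : R[i] :=
  let g (x : borel G) := f x * (chi x)^*%C in
  ((\int[mu]_x complex.Re (g x)) +i* (\int[mu]_x complex.Im (g x)))%C.

End amalgam.

Section A_space.
Context {R : realType} {G : topologicalZmodType}.
Variables (D : decomposition R G) (D' : decomposition R (character R G)).
Variables (mu : {measure set (borel G) -> \bar R})
          (mu' : {measure set (borel (character R G)) -> \bar R}).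

(* The spaces with exponents (p, 1) on [G] and (q, r) on the dual group. *)
Definition A_space (p q r : R) (nu : G -> R) (omega : character R G -> R) :
    set (G -> R[i]) :=
  [set f | weighted_amalgam D mu nu p 1 f /\
           weighted_amalgam D' mu' omega q r (fourier mu f)].

Definition A_norm (p q r : R) (nu : G -> R) (omega : character R G -> R)
    (f : G -> R[i]) : \bar R :=
  (weighted_amalgam_norm D mu nu p 1 f +
   weighted_amalgam_norm D' mu' omega q r (fourier mu f))%E.

End A_space.

Definition continuously_embedded (R : realType) (E : Type)
    (X : set E) (normX : E -> \bar R) (Y : set E) (normY : E -> \bar R) : Prop :=
  X `<=` Y /\
  exists c : R, 0 < c /\ forall f, X f -> (normY f <= c%:E * normX f)%E.

Definition weight_dominated (R : realType) (G : Type) (w2 w1 : G -> R) : Prop :=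
  exists C : R, 0 < C /\ forall x, w2 x <= C * w1 x.

(* Main.v *)
From HB Require Import structures.
Require Import Defs.
From mathcomp Require Import all_boot all_order all_algebra.
From mathcomp Require Import all_classical all_reals all_analysis.
From mathcomp Require Import measurable_realfun complex ring lra.

(** If [w2] is dominated by [w1], the embedding is immediate because the norms
are monotone in the weight.

Conversely, the inequality of norms is tested on the translates T_y f of one
function f.  Translation multiplies the Fourier transform by a function of
modulus one, so the dual part of the norm does not depend on y.  By
submultiplicativity the [w1]-norm of T_y f is at most a constant times w1(y), and
the cell that contains y shows that its [w2]-norm is at least a constant times
w2(y).  Since w1 is at least 1, the inequality gives w2(y) <= C w1(y).

The difficulty is to find such an f for arbitrary weights, which may grow
exponentially on both sides.  Here f is the Gaussian in the coordinate of R^a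
times the indicator function of R^a x H ([gauss]).  The decompositions of the
group and of its dual are unrelated, so everything is measured by growth alone.
A sequence of sets K_n that grows no faster than the sums of copies of a compact
set ([exhaustion]) meets at most exponentially many cells of any decomposition
([exhaustion_count]), and a Beurling weight grows at most exponentially along it,
because it is locally bounded ([beurling_locally_bounded],
[exhaustion_weight]).  A function that decays along K_n faster than any
exponential thus has finite weighted amalgam norms ([fast_decay_weight]), and
translation by y multiplies the bound by at most the weight at y
([fast_decay_amalgam]).

On the group, K_n is the box of radius n + 1 ([gauss_fast_decay]).  On the dual
group, K_n is the set of characters that stay near 1 on the box of radius
1 / (n + 1); these sets are compact by equicontinuity ([polar_compact]) and form
an exhaustion because characters of R^a can be divided by rescaling the argument
([dual_exhaustion_step]).

The decay of the transform of f comes from differences of f.  If a character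
is nontrivial on H, the transform vanishes there because f is invariant under H.
Otherwise, a character that is not near 1 on a small box moves away from 1 along
some axis at a small step s.  The m-th difference of f with this step has the
transform of f multiplied by the m-th power of a quantity bounded below, while its
integral is small by a Cauchy estimate for the entire function exp(c u - u^2),
obtained from the majorants of its power series ([iter_fdiff_gauss]).  With m
proportional to 1 / s this gives decay faster than any exponential
([fourier_gauss_fast_decay]). *)

Set Implicit Arguments.
Unset Strict Implicit.
Unset Printing Implicit Defensive.

Import Order.TTheory GRing.Theory Num.Theory.
Import numFieldNormedType.Exports.

Local Open Scope classical_set_scope.
Local Open Scope ring_scope.

Local Notation normc := ComplexField.Normc.normc.

(** * Finite differences of a Gaussian *)

Section finite_difference.
Context {R : realType}.
Implicit Types (h : R -> R) (p q : {poly R}) (s u c rho : R).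

Definition fdiff s h u := h u - h (u + s).

Lemma iter_fdiff_bound s n h u A :
  (forall k, (k <= n)%N -> `|h (u + k%:R * s)| <= A) ->
  `|iter n (fdiff s) h u| <= 2 ^+ n * A.
Proof.
elim: n h u => [|n IH] h u hA.
  by rewrite expr0 mul1r; have := hA 0%N isT; rewrite mul0r addr0.
rewrite iterS /fdiff exprS -mulrA mulr2n mulrDl mul1r.
rewrite (le_trans (ler_normB _ _))// lerD// IH// => k kn.
  exact/hA/leqW.
have -> : u + s + k%:R * s = u + k.+1%:R * s by rewrite -natr1; ring.
exact: hA.
Qed.

Lemma iter_fdiffD s n h1 h2 u :
  iter n (fdiff s) (h1 \+ h2) u =
  iter n (fdiff s) h1 u + iter n (fdiff s) h2 u.
Proof.
elim: n u => [//|n IH] u; rewrite !iterS /fdiff !IH; ring.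
Qed.

Lemma fdiff_poly s p : exists2 q,
  fdiff s (horner p) = horner q & (size q <= (size p).-1)%N.
Proof.
exists (p - (p \Po ('X + s%:P))).
  by apply/funext => u; rewrite /fdiff !hornerE horner_comp !hornerE.
have [->|p0] := eqVneq p 0; first by rewrite comp_poly0 subr0 size_poly0.
have sXs : size ('X + s%:P : {poly R}) = 2.
  by rewrite size_polyDl ?size_polyX// (leq_ltn_trans (size_polyC_leq1 _)).
have sc : size (p \Po ('X + s%:P)) = size p by rewrite size_comp_poly2.
apply/leq_sizeP => j; rewrite leq_eqVlt => /predU1P[<-|]; rewrite coefB.
  rewrite -{2}sc -!lead_coefE lead_coef_comp ?sXs//.
  rewrite lead_coefDl ?size_polyX ?(leq_ltn_trans (size_polyC_leq1 _))//.
  by rewrite lead_coefX expr1n mulr1 subrr.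
rewrite prednK ?size_poly_gt0// => pj.
by rewrite !nth_default ?sc ?subr0.
Qed.

(** Each difference lowers the degree. *)
Lemma iter_fdiff_poly0 s n p u : (size p <= n)%N ->
  iter n (fdiff s) (horner p) u = 0.
Proof.
elim: n p => [p|n IH p pn].
  by rewrite leqn0 size_poly_eq0 => /eqP->; rewrite /= horner0.
rewrite iterSr; have [q -> qp] := fdiff_poly s p.
by apply: IH; rewrite (leq_trans qp)//; case: (size p) pn.
Qed.

(** A series of majorants stands in for absolute convergence on a disc: the
value of a majorant at the radius bounds all the coefficients at once. *)
Definition majorant p q := forall i, `|p`_i| <= q`_i.

Lemma majorantD p1 p2 q1 q2 :
  majorant p1 q1 -> majorant p2 q2 -> majorant (p1 + p2) (q1 + q2).
Proof. by move=> h1 h2 i; rewrite !coefD (le_trans (ler_normD _ _))// lerD. Qed.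

Lemma majorantM p1 p2 q1 q2 :
  majorant p1 q1 -> majorant p2 q2 -> majorant (p1 * p2) (q1 * q2).
Proof.
move=> h1 h2 i; rewrite !coefM (le_trans (ler_norm_sum _ _ _))// ler_sum// => j _.
by rewrite normrM ler_pM.
Qed.

Lemma majorantZ a p q : 0 <= a -> majorant p q -> majorant (a *: p) (a *: q).
Proof. by move=> a0 h i; rewrite !coefZ normrM ger0_norm// ler_wpM2l. Qed.

Lemma majorantX p q n : majorant p q -> majorant (p ^+ n) (q ^+ n).
Proof.
move=> h; elim: n => [|n IH]; last by rewrite !exprS; exact: majorantM.
by move=> i; rewrite !expr0 !coef1; case: eqP; rewrite ?normr1 ?normr0.
Qed.

Lemma majorant_sum I (r : seq I) (p q : I -> {poly R}) :
  (forall i, majorant (p i) (q i)) ->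
  majorant (\sum_(i <- r) p i) (\sum_(i <- r) q i).
Proof.
move=> h; elim/big_ind2: _ => //; first by move=> i; rewrite !coef0 normr0.
by move=> *; exact: majorantD.
Qed.

Lemma majorant_tail p q n x rho : 0 < rho -> `|x| <= rho -> majorant p q ->
  `|(p - take_poly n p).[x]| <= (`|x| / rho) ^+ n * q.[rho].
Proof.
move=> r0 xr h; set N := maxn (size (p - take_poly n p)) (size q).
rewrite (@horner_coef_wide _ N) ?leq_maxl// (@horner_coef_wide _ N q) ?leq_maxr//.
rewrite (le_trans (ler_norm_sum _ _ _))// mulr_sumr ler_sum// => i _.
rewrite coefB coef_take_poly normrM normrX; case: ltnP => [_|ni].
  rewrite subrr normr0 mul0r mulr_ge0//.
    by rewrite exprn_ge0// divr_ge0// ltW.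
  by rewrite mulr_ge0 ?exprn_ge0 ?(ltW r0)// (le_trans _ (h i)).
rewrite subr0 mulrCA ler_pM// -(subnK ni) !exprD mulrC [(rho ^+ _ * _)%R]mulrC mulrA.
rewrite expr_div_n divfK ?expf_neq0 ?gt_eqF//.
by rewrite ler_wpM2l ?exprn_ge0// lerXn2r// nnegrE ltW.
Qed.

(** The Cauchy estimate, without complex analysis: differences kill the terms of
degree less than [n], and on the terms of degree at least [n] each power of the
radius [n * s] costs a factor [n * s / rho] with respect to the radius [rho]. *)
Lemma iter_fdiff_majorant s n p q rho : 0 < rho -> n%:R * `|s| <= rho ->
  majorant p q ->
  `|iter n (fdiff s) (horner p) 0| <= (2 * (n%:R * `|s|) / rho) ^+ n * q.[rho].
Proof.
move=> r0 nsr h.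
have -> : horner p = horner (take_poly n p) \+ horner (p - take_poly n p).
  by apply/funext => u /=; rewrite -hornerD addrC subrK.
rewrite iter_fdiffD iter_fdiff_poly0 ?size_take_poly// add0r.
have -> : (2 * (n%:R * `|s|) / rho) ^+ n * q.[rho] =
    2 ^+ n * ((n%:R * `|s| / rho) ^+ n * q.[rho]).
  by rewrite -mulrA exprMn mulrA.
apply: iter_fdiff_bound => k kn.
have kns : `|k%:R * s| <= n%:R * `|s| by rewrite normrM normr_nat ler_wpM2r// ler_nat.
rewrite add0r (le_trans (majorant_tail n r0 (le_trans kns nsr) h))//.
rewrite ler_wpM2r//.
  rewrite horner_coef sumr_ge0// => i _.
  by rewrite mulr_ge0 ?exprn_ge0 ?(ltW r0)// (le_trans _ (h i)).
by rewrite lerXn2r ?nnegrE ?divr_ge0 ?mulr_ge0 ?(ltW r0)// ler_wpM2r// invr_ge0 ltW.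
Qed.

Lemma iter_fdiff_cvg s n (h : nat -> R -> R) h0 :
  (forall u, h ^~ u @ \oo --> h0 u) ->
  forall u, (fun k => iter n (fdiff s) (h k) u) @ \oo --> iter n (fdiff s) h0 u.
Proof.
by move=> hh; elim: n => [//|n IH] u; rewrite iterS; apply: cvgB; exact: IH.
Qed.

(** The exponential is the limit of the partial sums of its power series in
[c * u - u ^+ 2], polynomials majorized by the same sums in
[`|c| * u + u ^+ 2]; the bound is the limit of the polynomial ones. *)
Lemma iter_fdiff_gauss s n c rho : 0 < rho -> n%:R * `|s| <= rho ->
  `|iter n (fdiff s) (fun u => expR (c * u - u ^+ 2)) 0| <=
  (2 * (n%:R * `|s|) / rho) ^+ n * expR (`|c| * rho + rho ^+ 2).
Proof.
move=> r0 nsr.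
pose T (x : {poly R}) N := \sum_(0 <= k < N) (k`!%:R^-1 *: x ^+ k).
have TE x N u : (T x N).[u] = series (exp_coeff x.[u]) N.
  rewrite /T horner_sum /series /=; apply: eq_bigr => k _.
  by rewrite hornerZ horner_exp exp_coeffE mulrC.
pose p : {poly R} := c *: 'X - 'X^2; pose q : {poly R} := `|c| *: 'X + 'X^2.
have pq : majorant p q.
  move=> i; rewrite /p /q coefB coefD !coefZ coefX coefXn.
  rewrite (le_trans (ler_normB _ _))// normrM !normr_nat.
  by rewrite lerD.
have Tpq N : majorant (T p N) (T q N).
  by apply: majorant_sum => k; apply: majorantZ; [rewrite invr_ge0|exact: majorantX].
have cT u : (T p N).[u] @[N --> \oo] --> expR (c * u - u ^+ 2).
  under eq_fun do rewrite TE.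
  have -> : p.[u] = c * u - u ^+ 2 by rewrite !hornerE.
  exact: is_cvg_series_exp_coeff.
have /cvg_norm ct := @iter_fdiff_cvg s n (fun N => horner (T p N)) _ cT 0.
rewrite -(cvg_lim _ ct)//; apply: limr_le; first exact: cvgP ct.
apply: nearW => N /=.
apply: (le_trans (iter_fdiff_majorant r0 nsr (Tpq N))).
rewrite ler_wpM2l ?exprn_ge0 ?divr_ge0 ?mulr_ge0 ?(ltW r0)//.
have -> : `|c| * rho + rho ^+ 2 = q.[rho] by rewrite /q !hornerE.
rewrite TE; apply: nondecreasing_cvgn_le; last exact: is_cvg_series_exp_coeff.
apply: nondecreasing_series => k _ _; apply: exp_coeff_ge0.
by rewrite /q !hornerE addr_ge0 ?mulr_ge0 ?exprn_ge0 ?(ltW r0).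
Qed.
End finite_difference.

(** * Borel sets and the geometry of a decomposition *)

(** The copy of the group that is pointed at zero inherits its topology, so that
the finite subcover property of compact sets, stated for pointed spaces, applies. *)
HB.instance Definition _ (G : topologicalZmodType) :=
  Topological.copy (pointed_group G) G.

Section borel_sets.
Context {R : realType} {G : topologicalZmodType}.
Implicit Types A K : set G.

Lemma borel_open A : open A -> measurable (A : set (borel G)).
Proof. by move=> oA; exact: sub_sigma_algebra. Qed.

Lemma borel_closed A : closed A -> measurable (A : set (borel G)).
Proof.
move=> cA; rewrite -[A]setCK; apply: measurableC.
by apply: borel_open; exact: closed_openC.
Qed.

Lemma continuous_borel_fun (f : G -> R) :
  continuous f -> measurable_fun [set: borel G] (f : borel G -> R).
Proof.
move=> /continuousP cf; apply: (measurability _ (RGenOpens.measurableE R)).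
move=> _ [_ [a [b ->]] <-]; rewrite setTI; apply: borel_open.
by apply: cf; exact: interval_open.
Qed.

Lemma continuous_borel_fun_group (f : G -> G) :
  continuous f -> measurable_fun [set: borel G] (f : borel G -> borel G).
Proof.
move=> /continuousP cf; apply: measurability => //.
by move=> _ [B oB <-]; rewrite setTI; apply: borel_open; exact: cf.
Qed.

Lemma group_compact_cover K : compact K ->
  cover_compact K.
Proof. by have /(congr1 (fun f => f K)) := @compact_cover (pointed_group G) => <-. Qed.

Lemma addl_continuous (v : G) : continuous (fun x => v + x : G).
Proof.
move=> x; apply: (@continuous_comp G (G * G)%type G (fun x => (v, x)) (fun x => x.1 + x.2)).
  by apply: cvg_pair; [exact: cvg_cst|exact: cvg_id].
exact: add_continuous.
Qed.

Lemma addr_continuous (v : G) : continuous (fun x => x + v : G).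
Proof. by under eq_fun do rewrite addrC; exact: addl_continuous. Qed.

End borel_sets.

Section geometry.
Context {R : realType} {G : topologicalZmodType} (D : decomposition R G).
Implicit Types (x y v : G) (s t : R).

Definition crd x (j : 'I_(dec_dim D)) : R := (dec_iso D x).1 ord0 j.

Lemma dec_iso0 : dec_iso D 0 = 0.
Proof. by apply: (@addrI _ (dec_iso D 0)); rewrite -dec_isoD !addr0. Qed.

Lemma dec_isoN x : dec_iso D (- x) = - dec_iso D x.
Proof. by apply: (@addrI _ (dec_iso D x)); rewrite -dec_isoD !subrr dec_iso0. Qed.

Lemma dec_isoB x y : dec_iso D (x - y) = dec_iso D x - dec_iso D y.
Proof. by rewrite dec_isoD dec_isoN. Qed.

Lemma dec_invD a b : @dec_inv _ _ D (a + b) = @dec_inv _ _ D a + @dec_inv _ _ D b.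
Proof. by apply: (can_inj (@dec_isoK _ _ D)); rewrite dec_isoD !dec_invK. Qed.

Lemma crdD x y j : crd (x + y) j = crd x j + crd y j.
Proof. by rewrite /crd dec_isoD mxE. Qed.

Lemma crdN x j : crd (- x) j = - crd x j.
Proof. by rewrite /crd dec_isoN mxE. Qed.

Lemma crd0 j : crd 0 j = 0.
Proof. by rewrite /crd dec_iso0 mxE. Qed.

Lemma crd_inv a j : crd (@dec_inv _ _ D a) j = a.1 ord0 j.
Proof. by rewrite /crd dec_invK. Qed.

Lemma crd_continuous j : continuous (crd ^~ j).
Proof.
move=> x; apply: (@continuous_comp _ _ _ (fun x => (dec_iso D x).1) (fun M => M ord0 j)).
  apply: (@continuous_comp _ _ _ (dec_iso D) fst); first exact: dec_iso_continuous.
  exact: cvg_fst.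
exact: coord_continuous.
Qed.

(** The open subgroup R^a x H, on which the Gaussian lives. *)
Definition kernel_part : set G := [set x | dec_subgroup D (dec_iso D x).2].

Lemma kernel_partB x y : kernel_part x -> kernel_part y -> kernel_part (x - y).
Proof. by rewrite /kernel_part /= dec_isoB; exact: dec_subgroupB. Qed.

Lemma kernel_part0 : kernel_part 0.
Proof. by rewrite /kernel_part /= dec_iso0; exact: dec_subgroup0. Qed.

Lemma kernel_partN x : kernel_part x -> kernel_part (- x).
Proof. by move=> ?; rewrite -sub0r; apply: kernel_partB => //; exact: kernel_part0. Qed.

Lemma kernel_partD x y : kernel_part x -> kernel_part y -> kernel_part (x + y).
Proof. by move=> ? ?; rewrite -[y]opprK; apply: kernel_partB => //; exact: kernel_partN. Qed.

Lemma kernel_part_open : open kernel_part.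
Proof.
have /continuousP c : continuous (fun x => (dec_iso D x).2).
  move=> x; apply: (@continuous_comp _ _ _ (dec_iso D) snd).
    exact: dec_iso_continuous.
  exact: cvg_snd.
exact/c/dec_subgroup_open.
Qed.

(** The compact set [-t, t]^a x H. *)
Definition box t : set G := [set x | (forall j, `|crd x j| <= t) /\ kernel_part x].

Lemma boxD s t x y : box s x -> box t y -> box (s + t) (x + y).
Proof.
move=> [sx Hx] [ty Hy]; split; last exact: kernel_partD.
by move=> j; rewrite crdD (le_trans (ler_normD _ _))// lerD.
Qed.

Lemma boxN t x : box t x -> box t (- x).
Proof.
move=> [tx Hx]; split; last exact: kernel_partN.
by move=> j; rewrite crdN normrN.
Qed.

Lemma box_le s t : s <= t -> box s `<=` box t.
Proof. by move=> st x [sx Hx]; split=> // j; exact: le_trans (sx j) st. Qed.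

Lemma box0 t : 0 <= t -> box t 0.
Proof. by move=> t0; split; [move=> j; rewrite crd0 normr0|exact: kernel_part0]. Qed.

Lemma box_compact t : compact (box t).
Proof.
have -> : box t = @dec_inv _ _ D @`
    ([set v : 'rV[R]_(dec_dim D) | forall j, `[- t, t]%classic (v ord0 j)] `*` dec_subgroup D).
  apply/seteqP; split=> [x [tx Hx]|_ [[v h] /= [tv Hh] <-]].
    exists (dec_iso D x); last exact: (@dec_isoK _ _ D).
    by split => // j /=; rewrite in_itv/= -ler_norml; exact: tx.
  split; last by rewrite /kernel_part /= dec_invK.
  by move=> j; rewrite crd_inv /= ler_norml; have := tv j; rewrite in_itv.
apply: continuous_compact.
  by apply: continuous_subspaceT; exact: dec_inv_continuous.
apply: compact_setX; last exact: dec_subgroup_compact.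
apply: (@rV_compact R _ (fun=> `[- t, t]%classic)) => _; exact: segment_compact.
Qed.

Lemma box_nbhs0 t : 0 < t -> nbhs 0 (box t).
Proof.
move=> t0; apply: filterI; last first.
  by apply: open_nbhs_nbhs; split; [exact: kernel_part_open|exact: kernel_part0].
apply: filter_forall => j.
have /cvgr_dist_le/(_ _ t0) := @crd_continuous j 0.
by apply: filterS => x; rewrite crd0 sub0r normrN.
Qed.

Lemma dec_hausdorff : hausdorff_space G.
Proof.
have c1 : continuous (fun x => (dec_iso D x).1).
  move=> x; apply: (@continuous_comp _ _ _ (dec_iso D) fst); first exact: dec_iso_continuous.
  exact: cvg_fst.
have c2 : continuous (fun x => (dec_iso D x).2).
  move=> x; apply: (@continuous_comp _ _ _ (dec_iso D) snd); first exact: dec_iso_continuous.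
  exact: cvg_snd.
move=> x y xy; apply: (can_inj (@dec_isoK _ _ D)).
suff: (dec_iso D x).1 = (dec_iso D y).1 /\ (dec_iso D x).2 = (dec_iso D y).2.
  by case: (dec_iso D x) (dec_iso D y) => [? ?] [? ?] /= [-> ->].
split.
  apply: norm_hausdorff => A B nA nB.
  have [z [Az Bz]] := xy _ _ (c1 _ _ nA) (c1 _ _ nB).
  by exists (dec_iso D z).1.
apply: dec_factor_hausdorff => A B nA nB.
have [z [Az Bz]] := xy _ _ (c2 _ _ nA) (c2 _ _ nB).
by exists (dec_iso D z).2.
Qed.

Lemma borel_compact K : compact K -> measurable (K : set (borel G)).
Proof.
move=> cK; apply: borel_closed; apply: compact_closed => //; exact: dec_hausdorff.
Qed.

(** Multiplication by [s] on the R^a factor, composed with the projection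
onto this factor.  It makes characters divisible: [x - shrink D s x] and
[shrink D s x] split [x] in the ratio of [1 - s] to [s]. *)
Definition shrink s x : G := @dec_inv _ _ D (s *: (dec_iso D x).1, 0).

Lemma shrinkD s x y : shrink s (x + y) = shrink s x + shrink s y.
Proof.
rewrite -dec_invD /shrink dec_isoD /=; congr (@dec_inv _ _ D _).
by rewrite scalerDr; congr (_, _); rewrite addr0.
Qed.

Lemma crd_shrink s x j : crd (shrink s x) j = s * crd x j.
Proof. by rewrite crd_inv /= mxE. Qed.

Lemma kernel_part_shrink s x : kernel_part (shrink s x).
Proof. by rewrite /kernel_part/= dec_invK; exact: dec_subgroup0. Qed.

Lemma shrink_continuous s : continuous (shrink s).
Proof.
have c : continuous (fun x => s *: (dec_iso D x).1).
  move=> x; apply: (@continuous_comp _ _ _ (fun x => (dec_iso D x).1) ( *:%R s)).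
    apply: (@continuous_comp _ _ _ (dec_iso D) fst); first exact: dec_iso_continuous.
    exact: cvg_fst.
  exact: scaler_continuous.
move=> x.
apply: (@continuous_comp G ('rV[R]_(dec_dim D) * dec_factor D)%type G
  (fun x => (s *: (dec_iso D x).1, 0)) (@dec_inv _ _ D)); last exact: dec_inv_continuous.
apply: (@cvg_pair _ _ _ _ (nbhs (s *: (dec_iso D x).1)) (nbhs 0)).
  exact: c.
exact: cvg_cst.
Qed.

(** Integer parts on the R^a factor, the transversal on the other one. *)
Lemma cell_coverP x : exists2 a, @dec_index _ _ D a & @dec_cell _ _ D a x.
Proof.
have [t [[Tt Ht] _]] := dec_transversalP (dec_iso D x).2.
exists (\row_j (Num.floor (crd x j))%:~R, t).
  by split => //= j; rewrite mxE intr_int.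
split => //= j; rewrite !mxE -/(crd x j).
have := floor_le (crd x j); have := floorD1_gt (crd x j); rewrite intrD => ? ?.
by apply/andP; split; lra.
Qed.

Lemma cell_disjoint a b x : @dec_index _ _ D a -> @dec_index _ _ D b ->
  @dec_cell _ _ D a x -> @dec_cell _ _ D b x -> a = b.
Proof.
case: a b => [a1 a2] [b1 b2] [/= ia Ta] [/= ib Tb] [/= ca Ha] [/= cb Hb].
congr (_, _); last first.
  have [t [_ tP]] := dec_transversalP (dec_iso D x).2.
  by rewrite -(tP a2)// -(tP b2).
apply/rowP => j.
have /intrP[m ma] := ia j; have /intrP[n nb] := ib j.
have := ca j; have := cb j; rewrite !mxE ma nb => /andP[b0 b1'] /andP[a0 a1'].
suff -> : m = n by [].
apply/eqP; rewrite eq_le -!ltzD1 -!(ltr_int R) !intrD.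
by apply/andP; split; lra.
Qed.

Lemma cell_sub a x y : @dec_cell _ _ D a x -> @dec_cell _ _ D a y -> box 1 (x - y).
Proof.
move=> [/= ax Hx] [/= ay Hy]; split.
  move=> j; rewrite crdD crdN; have := ax j; have := ay j.
  rewrite !mxE -!/(crd _ j) ler_norml => /andP[? ?] /andP[? ?].
  by apply/andP; split; lra.
rewrite /kernel_part /= dec_isoB /=.
by have := dec_subgroupB Hx Hy; rewrite /= opprB addrA subrK.
Qed.

Lemma cell_measurable a : measurable (@dec_cell _ _ D a).
Proof.
have -> : @dec_cell _ _ D a =
    (\bigcap_(j in [set: 'I_(dec_dim D)]) [set x | 0 <= crd (x - @dec_inv _ _ D a) j < 1])
    `&` [set x | kernel_part (x - @dec_inv _ _ D a)].
  apply/seteqP; split => [x [/= ax Hx]|x [ax Hx]]; split.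
  - by move=> j _; have := ax j; rewrite /= crdD crdN crd_inv !mxE.
  - by rewrite /kernel_part /= dec_isoB dec_invK.
  - by move=> j; have := ax j I; rewrite /= crdD crdN crd_inv !mxE.
  - by move: Hx; rewrite /kernel_part /= dec_isoB dec_invK.
have ct := @addr_continuous G (- @dec_inv _ _ D a).
apply: measurableI; last first.
  by apply: borel_open; have /continuousP := ct; apply; exact: kernel_part_open.
apply: fin_bigcap_measurable => // j _.
have mc : measurable_fun [set: borel G] (fun x : borel G => crd (x - @dec_inv _ _ D a) j).
  apply: continuous_borel_fun => x.
  apply: (@continuous_comp _ _ _ (fun x => x - @dec_inv _ _ D a) (crd ^~ j)); first exact: ct.
  exact: crd_continuous.
have := mc measurableT `[0, 1[%classic (measurable_itv _).
by rewrite setTI; congr measurable; apply/seteqP; split => x /=; rewrite in_itv.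
Qed.

End geometry.

(** * Translation invariance and Beurling weights *)

Section haar.
Context {R : realType} {G : topologicalZmodType} (D : decomposition R G).
Variable mu : {measure set (borel G) -> \bar R}.
Hypothesis mu_haar : normalized_haar D mu.
Implicit Types (x y v : G) (A K : set G).
Local Open Scope ereal_scope.

Lemma measurable_translate v : measurable_fun [set: borel G]
  ((fun x => x + v)%R : borel G -> borel G).
Proof. by apply: continuous_borel_fun_group; exact: addr_continuous. Qed.

Lemma measurable_preimage_translate v A : measurable (A : set (borel G)) ->
  measurable ([set x | A (x + v)%R] : set (borel G)).
Proof. by move=> mA; have := measurable_translate v measurableT mA; rewrite setTI. Qed.

Lemma haar_preimage_translate v A : measurable (A : set (borel G)) ->
  mu [set x | A (x + v)%R] = mu A.
Proof.
move=> mA; rewrite -(haar_translation mu_haar.1 (- v)%R mA); congr (mu _).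
apply/seteqP; split=> [x /= Ax|_ [a Aa <-] /=]; last by rewrite addrAC addNr add0r.
by exists (x + v)%R => //; rewrite addrCA addNr addr0.
Qed.

(** Translation invariance passes from the measure to integrals because the
measure is its own pushforward along a translation. *)
Lemma ge0_integral_translate v A (f : borel G -> \bar R) :
  measurable (A : set (borel G)) -> measurable_fun [set: borel G] f ->
  (forall x, 0 <= f x) ->
  \int[mu]_(x in [set x | A (x + v)%R]) f (x + v)%R = \int[mu]_(x in A) f x.
Proof.
move=> mA mf f0.
rewrite -(@ge0_integral_pushforward _ _ _ _ _ _ (measurable_translate v) mu A f)//.
  apply: eq_measure_integral; first exact: measurable_translate.
  by move=> mv B mB _; exact: haar_preimage_translate.
exact: measurable_funS mf.
Qed.

Lemma integrable_translate v (f : G -> R) :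
  mu.-integrable [set: borel G] (EFin \o f) ->
  mu.-integrable [set: borel G] (EFin \o (fun x => f (x + v)%R)).
Proof.
move=> /integrableP[mf fi]; apply/integrableP; split.
  exact: (measurableT_comp mf (measurable_translate v)).
have := @ge0_integral_translate v setT (fun x => `|(f x)%:E|) measurableT.
by move=> -> //; exact: measurableT_comp.
Qed.

Lemma Rintegral_translate v (f : G -> R) :
  mu.-integrable [set: borel G] (EFin \o f) ->
  (\int[mu]_x f (x + v) = \int[mu]_x f x)%R.
Proof.
move=> fi; congr fine.
have /measurable_int mf := fi.
rewrite -(@integral_pushforward _ _ _ _ _ _ (measurable_translate v) mu setT
  (EFin \o f))//; last exact: integrable_translate.
apply: eq_measure_integral; first exact: measurable_translate.
  by move=> mv B mB _; exact: haar_preimage_translate.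
Qed.

Lemma haar_cell a : mu (@dec_cell _ _ D a) = 1.
Proof.
rewrite -mu_haar.2.
rewrite -[RHS](haar_preimage_translate (- @dec_inv _ _ D a)%R); last exact: cell_measurable.
congr (mu _); apply/seteqP.
by split => x; rewrite /dec_cell /= subr0 dec_isoB dec_invK.
Qed.

Lemma haar_box_fin t : mu (box D t) \is a fin_num.
Proof. by rewrite ge0_fin_numE// (haar_compact mu_haar.1)//; exact: box_compact. Qed.

Lemma addset_compact A K : compact A -> compact K ->
  compact [set (x.1 + x.2)%R | x in A `*` K].
Proof.
move=> cA cK; apply: continuous_compact; last exact: compact_setX.
by apply: continuous_subspaceT; exact: add_continuous.
Qed.

Section weight.
Variable w : G -> R.
Hypothesis w_beurling : beurling_weight mu w.

Lemma beurling_ge0 x : (0 <= w x)%R.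
Proof. by case: w_beurling => _ _ w1 _; exact: le_trans (w1 x). Qed.

(** Submultiplicativity gives [w x <= w (x + y) * w (- y)]; averaging over the
[y] of a set of positive measure on which [w (- y)] is bounded leaves an
integral of [w] over a compact set.  The reflection is in the choice of the set
only, so translation invariance of the measure suffices. *)
Lemma beurling_locally_bounded K : compact K ->
  exists2 M, (1 <= M)%R & forall x, K x -> (w x <= M)%R.
Proof.
move=> cK; case: w_beurling => mw wl w1 wM.
pose E n : set (borel G) := @dec_cell _ _ D 0%R `&` [set y | w (- y) <= n%:R]%R.
have mwN : measurable_fun [set: borel G] ((fun y => w (- y)%R) : borel G -> R).
  apply: (measurableT_comp mw).
  by apply: continuous_borel_fun_group; exact: opp_continuous.
have mE n : measurable (E n).
  apply: measurableI; first exact: cell_measurable.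
  have := mwN measurableT _ (measurable_itv `]-oo, n%:R]).
  by rewrite setTI; congr measurable; apply/seteqP; split => y; rewrite /= in_itv.
have [n En0] : exists n, mu (E n) != 0.
  apply: contrapT => /forallNP E0.
  have : mu (@dec_cell _ _ D 0%R) <= 0.
    rewrite (_ : @dec_cell _ _ D 0%R = \bigcup_n E n).
      apply: (le_trans (le_mu_bigcup mu mE _)).
        exact: bigcup_measurable.
      rewrite eseries0// => i _ _; exact/eqP/negPn/negP/E0.
    apply/seteqP; split => [y Iy|y [n _ []]//].
    exists (Num.trunc (w (- y)%R)).+1 => //; split => //=.
    by rewrite ltW// truncnS_gt.
  by rewrite haar_cell lee_fin ler10.
have E1 : mu (E n) <= 1.
  rewrite -(haar_cell 0%R); apply: le_measure; last exact: subIsetl.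
    by rewrite inE; exact: mE.
  by rewrite inE; exact: cell_measurable.
pose L := [set (x.1 + x.2)%R | x in K `*` box D 1].
have cL : compact L by apply: addset_compact => //; exact: box_compact.
have mL : measurable (L : set (borel G)) by exact: (borel_compact D cL).
have key x : K x -> (w x)%:E * mu (E n) <= n%:R%:E * \int[mu]_(y in L) (w y)%:E.
  move=> Kx; rewrite -integral_cst//.
  apply: (@le_trans _ _ (\int[mu]_(y in E n) (n%:R%:E * (w (y + x))%:E))).
    apply: ge0_le_integral => //.
    - by move=> y _; rewrite lee_fin beurling_ge0.
    - apply: measurable_funS (measurableT) _ _ => //.
      apply/measurable_EFinP; apply: measurable_funM => //.
      exact: (measurableT_comp mw (measurable_translate x)).
    - move=> y [_ /= wy]; rewrite -EFinM lee_fin mulrC.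
      have := wM (y + x)%R (- y)%R; rewrite addrAC subrr add0r => /le_trans; apply.
      by rewrite ler_wpM2l// beurling_ge0.
  rewrite ge0_integralZl//; first last.
  - by move=> y _; rewrite lee_fin beurling_ge0.
  - apply: measurable_funS (measurableT) _ _ => //; apply/measurable_EFinP.
    exact: (measurableT_comp mw (measurable_translate x)).
  rewrite lee_wpmul2l ?lee_fin//.
  rewrite -(@ge0_integral_translate x L (fun y => (w y)%:E)) //; last 2 first.
  - exact/measurable_EFinP.
  - by move=> y; rewrite lee_fin beurling_ge0.
  apply: ge0_subset_integral => //.
  - exact: (measurable_preimage_translate x mL).
  - apply: measurable_funS (measurableT) _ _ => //; apply/measurable_EFinP.
    exact: (measurableT_comp mw (measurable_translate x)).
  - by move=> y _; rewrite lee_fin beurling_ge0.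
  move=> y [Iy _] /=; exists (x, y); last by rewrite /= addrC.
  split => //=; have := cell_sub Iy (_ : @dec_cell _ _ D 0%R 0%R).
  rewrite subr0; apply; split.
    by move=> j; rewrite subr0 dec_iso0 mxE lexx ltr01.
  by rewrite subr0 dec_iso0; exact: dec_subgroup0.
have Lfin := wl _ cL.
have Ifin : \int[mu]_(y in L) (w y)%:E \is a fin_num.
  by rewrite ge0_fin_numE// integral_ge0// => y _; rewrite lee_fin beurling_ge0.
have Efin : mu (E n) \is a fin_num.
  by rewrite ge0_fin_numE// (le_lt_trans E1)// ltry.
set I := fine (\int[mu]_(y in L) (w y)%:E); set e := fine (mu (E n)).
have e0 : (0 < e)%R by rewrite fine_gt0// lt0e En0 measure_ge0 -ge0_fin_numE.
exists (Num.max 1 (n%:R * I / e))%R; first by rewrite le_max lexx.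
move=> x Kx; rewrite le_max; apply/orP; right; rewrite ler_pdivlMr//.
have := key x Kx.
by rewrite -(fineK Ifin) -(fineK Efin) -!EFinM lee_fin.
Qed.

End weight.
End haar.

(** * Exhaustions and the sizes of their members *)

Section growth.
Context {R : realType} {G : topologicalZmodType} (D : decomposition R G).
Variable mu : {measure set (borel G) -> \bar R}.
Hypothesis mu_haar : normalized_haar D mu.
Implicit Types (x y z v : G) (K : nat -> set G).

(** Sets that grow no faster than the sums of copies of a fixed compact set.
Both a Beurling weight and the measure grow at most exponentially along such a
sequence. *)
Definition exhaustion K := [/\ compact (K 0%N), forall n, K n `<=` K n.+1 &
  forall n, K n.+1 `<=` [set x + y | x in K n & y in K 0%N]].

Lemma exhaustion_le K m n : exhaustion K -> (m <= n)%N -> K m `<=` K n.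
Proof.
move=> [_ KS _] /subnK <-; elim: (n - m)%N => [//|k IH].
by rewrite addSn => x /IH /KS.
Qed.

Lemma exhaustion_first K n x : exhaustion K -> K n x -> ~ K 0%N x ->
  exists2 m, K m.+1 x & ~ K m x.
Proof.
move=> eK; elim: n => [//|n IH] Kx K0x.
by have [Knx|Knx] := pselect (K n x); [exact: IH|exists n].
Qed.

Lemma exhaustion_weight K w : exhaustion K -> beurling_weight mu w ->
  exists2 M, 1 <= M & forall n x, K n x -> w x <= M ^+ n.+1.
Proof.
move=> [cK _ KS] bw; have [M M1 wM] := beurling_locally_bounded mu_haar bw cK.
exists M => // n; elim: n => [|n IH] x; first by rewrite expr1; exact: wM.
move=> /KS[y Ky] [z Kz] <-; case: (bw) => _ _ _ /(_ y z) /le_trans; apply.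
rewrite exprSr ler_pM ?(beurling_ge0 bw) ?IH ?wM//.
Qed.

Lemma translate_nbhs z v (V : set G) : nbhs v V -> nbhs (z + v) [set z + y | y in V].
Proof.
move=> nV; have := @addl_continuous _ (- z) (z + v).
rewrite /continuous_at /= addrA addNr add0r => /(_ _ nV) h.
have {}h : \forall x \near z + v, V (- z + x) by exact: h.
apply: filterS h => x /= Vx; exists (- z + x) => //.
by rewrite addrA subrr add0r.
Qed.

Definition cover_by (Z : seq G) : set G := [set z + y | z in [set` Z] & y in box D 1].

(** A compact set is covered by finitely many translates of the unit box, which
is a neighbourhood of zero; adding the first member of the exhaustion multiplies
the number of translates by a constant. *)
Lemma exhaustion_cover K : exhaustion K -> exists m : nat, forall n,
  exists2 Z : seq G, (size Z <= m ^ n.+1)%N &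
    [set x + y | x in K n & y in box D 1] `<=` cover_by Z.
Proof.
move=> [cK _ KS].
have [Z HZ] : exists Z : seq G, [set x + y | x in K 0%N & y in box D 1] `<=` cover_by Z.
  have cL : compact [set x.1 + x.2 | x in K 0%N `*` box D 1].
    by apply: addset_compact => //; exact: box_compact.
  have := group_compact_cover cL.
  move=> /(_ _ setT (fun z => [set z + y | y in box D 1]^°)) [].
  - by move=> z _; exact: open_interior.
  - move=> z _; exists z => //.
    by have := translate_nbhs z (box_nbhs0 D ltr01); rewrite addr0.
  move=> Z _ HZ; exists (finmap.enum_fset Z) => x [a Ka [b Bb abx]].
  have /HZ[z /= Zz] : [set x.1 + x.2 | x in K 0%N `*` box D 1] x.
    by exists (a, b).
  by move=> /interior_subset[y By <-]; exists z => //; exists y.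
exists (size Z); elim=> [|n [Zn sZn HZn]]; first by exists Z; rewrite ?expn1.
exists [seq z + y | z <- Zn, y <- Z].
  by rewrite size_allpairs expnS mulnC leq_mul.
move=> _ [x /KS[k Kk [k0 Kk0 <-]] [b Bb <-]].
have [z Zz [b' Bb' e]] : cover_by Z (k0 + b) by apply: HZ; exists k0 => //; exists b.
have [z' Zz' [b'' Bb'' e']] : cover_by Zn (k + b') by apply: HZn; exists k => //; exists b'.
exists (z' + z); first by apply/allpairsP; exists (z', z).
by exists b''=> //; rewrite addrAC e' -addrA [b' + z]addrC e addrA.
Qed.

Local Open Scope ereal_scope.

Lemma cover_by_measure y (Z : seq G) (A : set (borel G)) : measurable A ->
  A `<=` [set (y + x)%R | x in cover_by Z] ->
  mu A <= (size Z)%:R%:E * mu (box D 1).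
Proof.
elim: Z A => [|z Z IH] A mA sA.
  rewrite mul0e; have -> : A = set0.
    by rewrite -subset0 => x /sA [t [z Hz _] _]; move: Hz; rewrite /= in_nil.
  by rewrite measure0.
pose B : set (borel G) := [set x | box D 1 (x - (y + z))%R].
have mB : measurable B.
  by apply: measurable_preimage_translate; apply: (borel_compact D); exact: box_compact.
have mAB : measurable (A `\` B) by exact: measurableD.
apply: (@le_trans _ _ (mu (B `|` (A `\` B)))).
  apply: le_measure; rewrite ?inE//; first exact: measurableU.
  by move=> x Ax; have [?|?] := pselect (B x); [left|right].
apply: (le_trans (measureU2 _ mB mAB)).
rewrite [in leRHS]/= -natr1 EFinD muleDl ?(haar_box_fin mu_haar) ?fin_num_adde_defr// mul1e.
rewrite addeC; apply: leeD; last first.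
  have e : mu B = mu (box D 1).
    apply: (haar_preimage_translate mu_haar (- (y + z))%R).
    by apply: (borel_compact D); exact: box_compact.
  by have := lexx (mu B); rewrite {2}e; exact.
apply: IH => // x [Ax nBx]; have [_ [z' Zz' [b Bb <-]] xe] := sA _ Ax.
move: Zz'; rewrite /= inE => /orP[/eqP zz'|Zz'].
  case: nBx; rewrite /B /= -xe zz'.
  by have -> : (y + (z + b) = b + (y + z))%R; [rewrite addrA addrC|rewrite addrK].
by exists (z' + b)%R => //; exists z' => //; exists b.
Qed.

Definition cell_meets y (A : set G) (a : 'rV[R]_(dec_dim D) * dec_factor D) :=
  exists2 x, dec_cell a x & A (x - y)%R.

(** Cells are disjoint and of measure one, and those that meet a translate of
a member of the exhaustion lie in its sum with the unit box.  By translation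
invariance the bound does not depend on the translation. *)
Lemma exhaustion_count K : exhaustion K -> exists C m : R, [/\ (0 <= C)%R, (1 <= m)%R &
  forall y n X, finite_set X -> X `<=` @dec_index _ _ D `&` cell_meets y (K n) ->
   (\sum_(a \in X) (1 : \bar R) <= (C * m ^+ n)%:E)].
Proof.
move=> /exhaustion_cover[m Hm].
have bfin := haar_box_fin mu_haar 1; set b := fine (mu (box D 1)).
have b0 : (0 <= b)%R by rewrite fine_ge0.
exists (m.+1%:R * b)%R, m.+1%:R; split; [by rewrite mulr_ge0|by rewrite ler1n|].
move=> y n X finX sX.
rewrite (eq_fsbigr (fun a => mu (dec_cell a))); last first.
  by move=> a _; rewrite (haar_cell mu_haar).
rewrite -measure_fin_bigcup//; last 2 first.
- move=> a a' Xa Xa' [x [xa xa']]; apply: cell_disjoint xa xa'.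
  + exact: (sX _ Xa).1.
  + exact: (sX _ Xa').1.
- by move=> a _; exact: cell_measurable.
have [Z sZ HZ] := Hm n.
apply: (@le_trans _ _ ((size Z)%:R%:E * mu (box D 1))).
  apply: (@cover_by_measure y).
    by apply: fin_bigcup_measurable => // a _; exact: cell_measurable.
  move=> x [a Xa ax]; have [_ [x' ax' Kx']] := sX _ Xa.
  exists (x - y)%R; last by rewrite addrC subrK.
  apply: HZ; exists (x' - y)%R => //; exists (x - x')%R; first exact: cell_sub ax ax'.
  by rewrite addrC addrA subrK.
rewrite -(fineK bfin) -/b -EFinM lee_fin mulrAC -exprS ler_wpM2r//.
rewrite -natrX ler_nat (leq_trans sZ)// leq_exp2r//.
Qed.

End growth.

Section decay.
Context {R : realType} {G : topologicalZmodType} (D : decomposition R G).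
Variable mu : {measure set (borel G) -> \bar R}.
Hypothesis mu_haar : normalized_haar D mu.
Implicit Types (x y z v : G) (K : nat -> set G).

Section summation.
Local Open Scope ereal_scope.

(** The rate [theta] is chosen to beat the number of cells: a cell first met at
stage [n] contributes [theta ^+ n] up to a constant, and there are at most
[C * m ^+ n] of them, so a geometric series remains. *)
Lemma exhaustion_esum K : exhaustion K -> exists theta C : R,
  [/\ (0 < theta)%R, (theta <= 1)%R, (0 <= C)%R &
   forall y A (s : 'rV[R]_(dec_dim D) * dec_factor D -> \bar R), (0 <= A)%R ->
   (forall a, @dec_index _ _ D a -> s a <= A%:E) ->
   (forall a n, @dec_index _ _ D a -> ~ cell_meets y (K n) a -> s a <= (A * theta ^+ n)%:E) ->
   \esum_(a in @dec_index _ _ D) s a <= (C * A)%:E].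
Proof.
move=> eK; have [C [m [C0 m1 Hcount]]] := exhaustion_count mu_haar eK.
have m0 : (0 < m)%R by exact: lt_le_trans m1.
(* With this rate the number of cells leaves a geometric series of ratio 1/2. *)
pose t : R := (2 * m)^-1%R.
have t0 : (0 < t)%R by rewrite invr_gt0 mulr_gt0.
have t1 : (t <= 1)%R by rewrite invf_le1 ?mulr_gt0//; lra.
exists t, (C / t * 2)%R; split => //.
  by apply: mulr_ge0 => //; apply: divr_ge0 => //; exact: ltW.
move=> y A s A0 sA sK; apply: ge_ereal_sup => _ [X [finX XJ] <-].
pose c n : R := (A / t * t ^+ n)%R.
have c0 n : (0 <= c n)%R.
  by apply: mulr_ge0; [apply: divr_ge0 => //; exact: ltW|rewrite exprn_ge0// ltW].
have /choice[f Hf] : forall a, exists n, @dec_index _ _ D a ->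
    (cell_meets y (K n) a /\ s a <= (c n)%:E) \/ s a <= 0.
  move=> a; have [Ja|] := pselect (@dec_index _ _ D a); last by exists 0%N.
  have [[n Kn]|/forallNP noK] := pselect (exists n, cell_meets y (K n) a).
    have [K0|K0] := pselect (cell_meets y (K 0%N) a).
      exists 0%N => _; left; split=> //; apply: (le_trans (sA _ Ja)).
      by rewrite lee_fin /c expr0 mulr1 ler_pdivlMr// ler_piMr.
    have [k Kk Kk'] : exists2 k, cell_meets y (K k.+1) a & ~ cell_meets y (K k) a.
      elim: n Kn => [//|n IH] Kn.
      by have [Kn'|Kn'] := pselect (cell_meets y (K n) a); [exact: IH|exists n].
    exists k.+1 => _; left; split => //; apply: (le_trans (sK _ _ Ja Kk')).
    by rewrite lee_fin /c exprS mulrA divfK ?gt_eqF.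
  exists 0%N => _; right; apply/lee_addgt0Pr => e e0; rewrite add0e.
  have : (A * t ^+ n)%R @[n --> \oo] --> (A * 0)%R.
    by apply: cvgMr; apply: cvg_expr; rewrite ger0_norm ?ltW// invf_lt1 ?mulr_gt0//; lra.
  rewrite mulr0 => /cvgr0_norm_le/(_ _ e0)[N _ /(_ N)] /= /(_ (leqnn _)) HN.
  apply: (le_trans (sK _ N Ja (noK N))); rewrite lee_fin.
  exact: le_trans (ler_norm _) HN.
pose N := (\max_(a <- finmap.enum_fset (fset_set X)) f a)%N.
have fN a : X a -> (f a <= N)%N.
  by move=> Xa; apply: (@leq_bigmax_seq _ _ xpredT) => //; rewrite in_fset_set// inE.
pose M n := [set a : 'rV[R]_(dec_dim D) * dec_factor D | cell_meets y (K n) a].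
apply: (@le_trans _ _ (\sum_(a \in X) \sum_(n < N.+1)
    ((c n)%:E * (if a \in M n then 1 else 0)))).
  apply: lee_fsum => // a Xa.
  have ge0 (n : 'I_N.+1) : 0 <= (c n)%:E * (if a \in M n then 1 else 0).
    by case: ifP => _; rewrite ?mule0// mule1 lee_fin.
  have [[Kf sf]|s0] := Hf a (XJ _ Xa); last by rewrite (le_trans s0)// sume_ge0.
  have fa : (f a < N.+1)%N by rewrite ltnS fN.
  rewrite (bigD1 (Ordinal fa))//= ifT ?inE// mule1.
  by rewrite -[leLHS]adde0 leeD// sume_ge0.
rewrite fsbig_finite// exchange_big /=.
apply: (@le_trans _ _ (\sum_(n < N.+1) ((C * A / t) * 2^-1 ^+ n)%:E)).
  apply: lee_sum => n _; rewrite -fsbig_finite// -ge0_mule_fsumr; last by move=> a; case: ifP.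
  rewrite -fsbig_mkcondr.
  apply: (@le_trans _ _ ((c n)%:E * (C * m ^+ n)%:E)).
    rewrite lee_wpmul2l ?lee_fin// (Hcount y)//; first exact: finite_setIl.
    by move=> a [Xa Ma]; split => //; exact: XJ.
  rewrite -EFinM lee_fin /c /t le_eqVlt; apply/orP; left; apply/eqP.
  rewrite !exprVn exprMn; field.
  by rewrite !expf_neq0 ?gt_eqF.
rewrite sumEFin lee_fin -mulr_sumr.
have := @geometric_le_lim R N.+1 1 2^-1 ler01.
rewrite invr_gt0 ltr0n ger0_norm// invf_lt1// ltr1n => /(_ isT isT).
rewrite /series /= big_mkord.
rewrite (eq_bigr (fun i : 'I_N.+1 => 2^-1 ^+ i)%R); last by move=> i _; rewrite mul1r.
rewrite (_ : 1 / (1 - 2^-1) = 2 :> R)%R; last by field.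
move=> h; rewrite (_ : C / t * 2 * A = C * A / t * 2)%R; last by ring.
rewrite ler_wpM2l//; apply: divr_ge0; last exact: ltW.
exact: mulr_ge0.
Qed.

End summation.

End decay.

(** * Fast decaying functions and amalgam norms *)

Section modulus.
Context {R : realType} {G : topologicalZmodType} (D : decomposition R G).
Variable mu : {measure set (borel G) -> \bar R}.
Hypothesis mu_haar : normalized_haar D mu.
Implicit Types (x y z v : G) (K : nat -> set G) (f g : G -> R[i]).


Lemma normc_sqrtE (z : R[i]) : normc z = Num.sqrt (complex.Re z ^+ 2 + complex.Im z ^+ 2).
Proof. by case: z. Qed.

Lemma normc_ge0 (z : R[i]) : 0 <= normc z.
Proof. by rewrite normc_sqrtE sqrtr_ge0. Qed.

Lemma normcR (a : R) : normc a%:C%C = `|a|.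
Proof. by rewrite normc_sqrtE /= expr0n addr0 sqrtr_sqr. Qed.

Lemma measurable_modulus f : complex_measurable f ->
  measurable_fun [set: borel G] (modulus f).
Proof.
move=> [mr mi].
have -> : modulus f = fun x : borel G =>
    Num.sqrt (complex.Re (f x) ^+ 2 + complex.Im (f x) ^+ 2).
  by apply/funext => x; rewrite /modulus normc_sqrtE.
apply: (@measurableT_comp _ _ _ _ _ _ (@Num.sqrt R)).
  by apply: continuous_measurable_fun; exact: sqrt_continuous.
by apply: measurable_funD; exact: measurable_funX.
Qed.

Lemma complex_measurableZ f (w : G -> R) : complex_measurable f ->
  measurable_fun [set: borel G] (w : borel G -> R) ->
  complex_measurable (fun x => f x * (w x)%:C%C).
Proof.
move=> [mr mi] mw; split.
- have -> : (fun x : borel G => complex.Re (f x * (w x)%:C%C)) =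
      fun x => complex.Re (f x) * w x.
    by apply/funext => x; case: (f x) => a b /=; rewrite mulr0 subr0.
  exact: measurable_funM.
- have -> : (fun x : borel G => complex.Im (f x * (w x)%:C%C)) =
      fun x => complex.Im (f x) * w x.
    by apply/funext => x; case: (f x) => a b /=; rewrite mulr0 add0r.
  exact: measurable_funM.
Qed.

Lemma modulusZ f (w : G -> R) x : 0 <= w x ->
  modulus (fun x => f x * (w x)%:C%C) x = modulus f x * w x.
Proof. by move=> w0; rewrite /modulus ComplexField.Normc.normcM normcR ger0_norm. Qed.

Lemma measurable_modulus_powR f p A : complex_measurable f ->
  measurable_fun A (fun x : borel G => (modulus f x `^ p)%:E).
Proof.
move=> mf; apply: measurable_funS (measurableT) _ _ => //; apply/measurable_EFinP.
exact: (measurableT_comp (measurable_powR p) (measurable_modulus mf)).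
Qed.

Lemma bounded_Lp_loc p f A : 0 <= p -> complex_measurable f ->
  (forall x, modulus f x <= A) -> Lp_loc mu p f.
Proof.
move=> p0 mf fA; split => // K cK.
have mK := borel_compact D cK.
have A0 : 0 <= A by apply: le_trans (fA 0); exact: normc_ge0.
apply: (@le_lt_trans _ _ (\int[mu]_(x in (K : set (borel G))) cst (A `^ p)%:E x)%E).
  apply: ge0_le_integral => //.
  - by move=> x _; rewrite lee_fin powR_ge0.
  - exact: measurable_modulus_powR.
  - by move=> x _; rewrite lee_fin ge0_ler_powR// nnegrE normc_ge0.
rewrite integral_cst// lte_mul_pinfty ?lee_fin ?powR_ge0//.
exact: haar_compact mu_haar.1 _ cK.
Qed.

Lemma Lp_norm_on_cell_le p a f A : 0 < p -> complex_measurable f -> 0 <= A ->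
  (forall x, dec_cell a x -> modulus f x <= A) ->
  (Lp_norm_on mu p (@dec_cell _ _ D a) f <= A%:E)%E.
Proof.
move=> p0 mf A0 fA; rewrite /Lp_norm_on.
have mC := cell_measurable a.
have -> : A%:E = (((A `^ p)%:E) `^ p^-1)%E.
  by rewrite poweR_EFin -powRrM divff ?gt_eqF// powRr1.
apply: gt0_ler_poweR.
- by rewrite invr_ge0 ltW.
- by rewrite in_itv /= leey andbT integral_ge0// => x _; rewrite lee_fin powR_ge0.
- by rewrite in_itv /= leey andbT lee_fin powR_ge0.
apply: (@le_trans _ _ (\int[mu]_(x in @dec_cell _ _ D a) cst (A `^ p)%:E x)%E).
  apply: ge0_le_integral => //.
  - by move=> x _; rewrite lee_fin powR_ge0.
  - exact: measurable_modulus_powR.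
  - by move=> x ax; rewrite lee_fin ge0_ler_powR ?(ltW p0)// ?nnegrE ?normc_ge0// fA.
by rewrite integral_cst// (haar_cell mu_haar) mule1.
Qed.

Lemma Lp_norm_on_cell_ge p a f A : 0 < p -> complex_measurable f -> 0 <= A ->
  (forall x, dec_cell a x -> A <= modulus f x) ->
  (A%:E <= Lp_norm_on mu p (@dec_cell _ _ D a) f)%E.
Proof.
move=> p0 mf A0 fA; rewrite /Lp_norm_on.
have mC := cell_measurable a.
have -> : A%:E = (((A `^ p)%:E) `^ p^-1)%E.
  by rewrite poweR_EFin -powRrM divff ?gt_eqF// powRr1.
apply: gt0_ler_poweR.
- by rewrite invr_ge0 ltW.
- by rewrite in_itv /= leey andbT lee_fin powR_ge0.
- by rewrite in_itv /= leey andbT integral_ge0// => x _; rewrite lee_fin powR_ge0.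
apply: (@le_trans _ _ (\int[mu]_(x in @dec_cell _ _ D a) cst (A `^ p)%:E x)%E).
  by rewrite integral_cst// (haar_cell mu_haar) mule1.
apply: ge0_le_integral => //.
- by move=> x _; rewrite lee_fin powR_ge0.
- exact: measurable_modulus_powR.
- by move=> x ax; rewrite lee_fin ge0_ler_powR ?(ltW p0)// ?nnegrE ?normc_ge0// fA.
Qed.

(** On a cell of measure one the [L^p] norm is at most the supremum, so the
previous summation applies to the suprema. *)
Lemma amalgam_norm_exhaustion K p q : 0 < p -> 1 <= q -> exhaustion K ->
  exists theta C : R, [/\ 0 < theta, 0 <= C &
   forall y A f, complex_measurable f -> 0 <= A ->
   (forall x, modulus f x <= A) ->
   (forall x n, ~ K n (x - y) -> modulus f x <= A * theta ^+ n) ->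
   (amalgam_norm D mu p q f <= ((C * A `^ q) `^ q^-1)%:E)%E].
Proof.
move=> p0 q1 eK; have [t [C [t0 t1 C0 H]]] := exhaustion_esum mu_haar eK.
have q0 : 0 < q by exact: lt_le_trans q1.
exists t, C; split => // y A f mf A0 fA fK.
rewrite /amalgam_norm -poweR_EFin; apply: gt0_ler_poweR.
- by rewrite invr_ge0 ltW.
- by rewrite in_itv /= leey andbT esum_ge0// => a _; exact: poweR_ge0.
- by rewrite in_itv /= leey andbT lee_fin mulr_ge0// powR_ge0.
have pow_le a B : 0 <= B -> (Lp_norm_on mu p (@dec_cell _ _ D a) f <= B%:E)%E ->
    ((Lp_norm_on mu p (@dec_cell _ _ D a) f) `^ q <= (B `^ q)%:E)%E.
  move=> B0 h; rewrite -poweR_EFin; apply: gt0_ler_poweR => //.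
  - exact: ltW.
  - by rewrite in_itv /= leey andbT; exact: poweR_ge0.
  - by rewrite in_itv /= leey andbT lee_fin.
apply: (H y); first exact: powR_ge0.
  move=> a _; apply: pow_le => //; apply: Lp_norm_on_cell_le => // x _; exact: fA.
move=> a n _ aK.
have tn0 : 0 <= t ^+ n by rewrite exprn_ge0 ?ltW.
apply: (@le_trans _ _ (((A * t ^+ n) `^ q)%:E)).
  apply: pow_le; first exact: mulr_ge0.
  apply: Lp_norm_on_cell_le => //; first exact: mulr_ge0.
  by move=> x ax; apply: fK => Kx; apply: aK; exists x.
rewrite lee_fin powRM// ler_wpM2l ?powR_ge0//.
have := @ger_powR _ (t ^+ n) _ 1 q.
rewrite powRr1//; apply => //.
by apply/andP; split; [exact: exprn_gt0|apply: exprn_ile1 => //; exact: ltW].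
Qed.

(** Decay faster than any exponential in the index of the exhaustion.  This is
the property that both sides of the Fourier transform can share, and it
survives multiplication by any Beurling weight. *)
Definition fast_decay K (u : G -> R) := (exists A, forall x, `|u x| <= A) /\
  forall e, 0 < e -> exists A, forall x n, ~ K n x -> `|u x| <= A * e ^+ n.

Lemma fast_decay0 K u x : fast_decay K u -> (forall n, ~ K n x) -> u x = 0.
Proof.
move=> [_ /(_ 2^-1)[|A HA nK]]; first by rewrite invr_gt0.
apply/normr0_eq0/eqP; rewrite eq_le normr_ge0 andbT.
have c : A * 2^-1 ^+ n @[n --> \oo] --> A * 0.
  by apply: cvgMr; apply: cvg_expr; rewrite ger0_norm// invf_lt1// ltr1n.
rewrite -[0](mulr0 A) -(cvg_lim _ c)//; apply: limr_ge; first exact: cvgP c.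
by apply: nearW => n; apply: HA; exact: nK.
Qed.

(** At a point that enters the exhaustion at stage [k + 1] the weight is at most
[M ^+ k.+2], while the function is as small as a [k]-th power of any rate. *)
Lemma fast_decay_weight K u w : exhaustion K -> beurling_weight mu w ->
  fast_decay K u -> fast_decay K (fun x => u x * w x).
Proof.
move=> eK bw du; have [M M1 wM] := exhaustion_weight mu_haar eK bw.
have M0 : 0 < M by exact: lt_le_trans M1.
have w0 x : 0 <= w x by exact: beurling_ge0 bw x.
have decay e : 0 < e -> exists A, forall x n, ~ K n x -> `|u x * w x| <= A * e ^+ n.
  move=> e0; pose e1 := Num.min e 1.
  have e10 : 0 < e1 by rewrite lt_min e0 ltr01.
  have [A HA] := du.2 (e1 / M) (divr_gt0 e10 M0).
  exists (`|A| * M ^+ 2) => x n nKx.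
  have [[m Km]|/forallNP nK] := pselect (exists m, K m x); last first.
    rewrite (fast_decay0 du nK) mul0r normr0 mulr_ge0 ?exprn_ge0 ?(ltW e0)//.
    by rewrite mulr_ge0// exprn_ge0// ltW.
  have nK0 : ~ K 0%N x by move=> K0; apply: nKx; exact: exhaustion_le K0.
  have [k Kk nKk] := exhaustion_first eK Km nK0.
  have nk : (n <= k)%N.
    by rewrite leqNgt; apply/negP => kn; apply: nKx; exact: exhaustion_le kn _ Kk.
  rewrite normrM [`|w x|]ger0_norm//.
  apply: (@le_trans _ _ (`|A| * (e1 / M) ^+ k * M ^+ k.+2)).
    rewrite ler_pM//; last exact: wM.
    apply: (le_trans (HA _ _ nKk)); rewrite ler_wpM2r ?ler_norm//.
    by rewrite exprn_ge0// divr_ge0// ltW.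
  have -> : `|A| * (e1 / M) ^+ k * M ^+ k.+2 = `|A| * M ^+ 2 * e1 ^+ k.
    rewrite -(addn2 k) exprD expr_div_n; field.
    by rewrite expf_neq0 ?gt_eqF.
  rewrite ler_wpM2l ?mulr_ge0 ?exprn_ge0 ?(ltW M0)//.
  apply: (@le_trans _ _ (e1 ^+ n)).
    by apply: ler_wiXn2l => //; [exact: ltW|rewrite ge_min lexx orbT].
  by rewrite lerXn2r ?nnegrE ?(ltW e0) ?(ltW e10)// ge_min lexx.
split=> //; have [A HA] := decay 1 ltr01; have [B HB] := du.1.
exists (Num.max A (B * M)) => x; rewrite le_max.
have [K0|K0] := pselect (K 0%N x); last first.
  by apply/orP; left; have := HA x 0%N K0; rewrite expr0 mulr1.
apply/orP; right; rewrite normrM [`|w x|]ger0_norm// ler_pM//.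
by have := wM 0%N x K0; rewrite expr1.
Qed.

(** The constant depends neither on the translation [y] nor on the function
that is dominated, which is what makes translates usable as test functions. *)
Lemma fast_decay_amalgam K p q u : 0 < p -> 1 <= q -> exhaustion K ->
  fast_decay K u -> exists2 B : R, 0 <= B &
  forall y c f, 0 <= c -> complex_measurable f ->
    (forall x, modulus f x <= c * `|u (x - y)|) ->
    (amalgam_norm D mu p q f <= ((B * c `^ q) `^ q^-1)%:E)%E.
Proof.
move=> p0 q1 eK du.
have [t [C [t0 C0 H]]] := amalgam_norm_exhaustion p0 q1 eK.
have [A HA] := du.1; have [A' HA'] := du.2 t t0.
pose A1 := Num.max `|A| `|A'|.
have A10 : 0 <= A1 by rewrite le_max normr_ge0.
exists (C * A1 `^ q); first by rewrite mulr_ge0// powR_ge0.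
move=> y c f c0 mf fu.
rewrite -mulrA [_ `^ q * _]mulrC -powRM//.
apply: (H y) => //; first exact: mulr_ge0.
  move=> x; apply: (le_trans (fu x)); rewrite ler_wpM2l//.
  by rewrite (le_trans (HA _))// le_max ler_norm.
move=> x n nK; apply: (le_trans (fu x)); rewrite -mulrA ler_wpM2l//.
apply: (le_trans (HA' _ _ nK)); rewrite ler_wpM2r ?exprn_ge0 ?(ltW t0)//.
by rewrite le_max [X in _ || X]ler_norm orbT.
Qed.

End modulus.

(** * Characters and an exhaustion of the dual group *)

Section characters.
Context {R : realType} {G : topologicalZmodType} (D : decomposition R G).
Implicit Types (x y z v : G) (chi psi : character R G) (s t : R).

Lemma normCE (z : R[i]) : `|z| = (normc z)%:C%C.
Proof. by rewrite normc_def normc_sqrtE. Qed.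

Lemma gt0_complex_real (e : R[i]) : 0 < e -> exists2 e1 : R, 0 < e1 & e = e1%:C%C.
Proof.
move=> e0; exists (complex.Re e); first by move: e0; rewrite ltcE => /andP[].
by move: e0; case: e => a b; rewrite ltcE /= => /andP[/eqP -> _].
Qed.

Lemma two_thirds_expr_small (e : R) : 0 < e -> exists k, (2 / 3) ^+ k / 2 < e.
Proof.
move=> e0; have c : ((2 / 3) ^+ k / 2 : R) @[k --> \oo] --> (0 / 2 : R).
  apply: cvgMl; apply: cvg_expr; rewrite ger0_norm ?divr_ge0//.
  by rewrite ltr_pdivrMr// mul1r ltr_nat.
move: c; rewrite mul0r => /cvgr0_norm_lt/(_ _ e0)[k _ /(_ k (leqnn _))] /= hk.
by exists k; exact: le_lt_trans (ler_norm _) hk.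
Qed.

Lemma normc_sqr (z : R[i]) : normc z ^+ 2 = complex.Re z ^+ 2 + complex.Im z ^+ 2.
Proof. by rewrite normc_sqrtE sqr_sqrtr// addr_ge0// sqr_ge0. Qed.

Lemma normc_le_sqr (z : R[i]) t : 0 <= t ->
  (normc z <= t) = (complex.Re z ^+ 2 + complex.Im z ^+ 2 <= t ^+ 2).
Proof. by move=> t0; rewrite -normc_sqr ler_pXn2r// nnegrE ?normc_ge0. Qed.

Lemma le_normc_add (z1 z2 : R[i]) : normc (z1 + z2) <= normc z1 + normc z2.
Proof. by have := ler_normD z1 z2; rewrite !normCE -rmorphD lecR. Qed.

Lemma normc_sub (z1 z2 : R[i]) : normc (z1 - z2) = normc (z2 - z1).
Proof. by have := distrC z1 z2; rewrite !normCE => -[]. Qed.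

Lemma normcM (z1 z2 : R[i]) : normc (z1 * z2) = normc z1 * normc z2.
Proof. exact: ComplexField.Normc.normcM. Qed.

Lemma normc_conj (z : R[i]) : normc z^*%C = normc z.
Proof. by have := normcJ z; rewrite !normCE => -[]. Qed.

Lemma normc1 : normc (1 : R[i]) = 1.
Proof. exact: ComplexField.Normc.normc1. Qed.

Lemma normc_character chi x : normc (chi x) = 1.
Proof. by have := character_norm chi x; rewrite normCE => -[]. Qed.

(** The facts about characters used below hold, before continuity is known, for
every multiplicative function of modulus one; limits of characters along an
ultrafilter are handled in this form. *)
Section unitary.
Variable g : G -> R[i].
Hypotheses (g1 : forall x, normc (g x) = 1) (gD : forall x y, g (x + y) = g x * g y).

Lemma unitary0 : g 0 = 1.
Proof.
have /mulfI : g 0 != 0.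
  by apply: contra_eq_neq (g1 0) => ->; rewrite ComplexField.Normc.normc0 eq_sym oner_eq0.
by apply; rewrite -gD addr0 mulr1.
Qed.

Lemma unitary_dist1D x y : normc (g (x + y) - 1) <= normc (g x - 1) + normc (g y - 1).
Proof.
have -> : g (x + y) - 1 = g x * (g y - 1) + (g x - 1) by rewrite gD; ring.
by rewrite (le_trans (le_normc_add _ _))// normcM g1 mul1r addrC.
Qed.

Lemma unitary_dist x y : normc (g x - g y) = normc (g (x - y) - 1).
Proof.
have -> : g x - g y = g y * (g (x - y) - 1) by rewrite mulrBr mulr1 -gD [y + _]addrC subrK.
by rewrite normcM g1 mul1r.
Qed.

(** If z is close to 1, then z + 1 is far from 0 and z - 1 is a quotient of
z ^ 2 - 1. *)
Lemma unitary_half x : normc (g x - 1) <= 1 / 2 ->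
  normc (g x - 1) <= 2 / 3 * normc (g (x + x) - 1).
Proof.
move=> h; have -> : g (x + x) - 1 = (g x - 1) * (g x + 1) by rewrite gD; ring.
have : normc (1 + 1 : R[i]) <= normc (g x + 1) + normc (g x - 1).
  rewrite [normc (g x - 1)]normc_sub; have -> : 1 + 1 = (g x + 1) + (1 - g x) by ring.
  exact: le_normc_add.
rewrite (_ : normc (1 + 1 : R[i]) = 2); last first.
  by rewrite normc_sqrtE /= addr0 expr0n addr0 sqrtr_sqr ger0_norm.
by rewrite normcM => h'; have := normc_ge0 (g x - 1); nra.
Qed.

(** Repeated halving: a bound on a box forces an explicit modulus of continuity
at zero, the same for all characters of a polar. *)
Lemma unitary_small t : (forall x, box D t x -> normc (g x - 1) <= 1 / 2) ->
  0 <= t -> forall k x, box D (t / 2 ^+ k) x -> normc (g x - 1) <= (2 / 3) ^+ k / 2.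
Proof.
move=> gt t0; elim=> [|k IH] x.
  by rewrite expr0 divr1; exact: gt.
move=> xk; have xx : box D (t / 2 ^+ k) (x + x).
  have -> : t / 2 ^+ k = t / 2 ^+ k.+1 + t / 2 ^+ k.+1.
    by rewrite exprS; field; rewrite expf_neq0.
  exact: boxD.
have xt : box D t x.
  apply: box_le xk; rewrite ler_pdivrMr ?exprn_gt0// ler_peMr// exprn_ege1//.
  by rewrite ler1n.
apply: (le_trans (unitary_half (gt _ xt))).
rewrite [in leRHS]exprS -[leRHS]mulrA; apply: ler_wpM2l; first exact: divr_ge0.
exact: IH.
Qed.

Lemma unitary_continuous t : 0 < t -> (forall k x, box D (t / 2 ^+ k) x ->
  normc (g x - 1) <= (2 / 3) ^+ k / 2) -> continuous (g : G -> R[i]^o).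
Proof.
move=> t0 gs x; apply/(@cvgrPdist_lt R[i] R[i]^o G (nbhs x) _ _ _) => e e0.
have [e1 e10 eE] := gt0_complex_real e0.
have [k hk] := two_thirds_expr_small e10.
have tk : 0 < t / 2 ^+ k by rewrite divr_gt0// exprn_gt0.
have nb := translate_nbhs x (box_nbhs0 D tk); rewrite addr0 in nb.
apply: filterS nb => _ [v vb <-].
rewrite eE normCE ltcR unitary_dist (le_lt_trans _ hk)// gs//.
by rewrite opprD addrA subrr add0r; exact: boxN.
Qed.

End unitary.

Definition polar t : set (character R G) :=
  [set chi | forall x, box D t x -> normc (chi x - 1) <= 1 / 2].

Lemma polar_small t chi k x : 0 <= t -> polar t chi -> box D (t / 2 ^+ k) x ->
  normc (chi x - 1) <= (2 / 3) ^+ k / 2.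
Proof.
move=> t0 pchi.
exact: (unitary_small (@characterD R G chi) pchi t0).
Qed.


Lemma character0 chi : chi 0 = 1.
Proof. exact: (unitary0 (normc_character chi) (@characterD R G chi)). Qed.

Lemma polar_le s t : s <= t -> polar t `<=` polar s.
Proof. by move=> st chi pchi x xs; apply: pchi; exact: box_le xs. Qed.

Lemma shrink_norm s chi x : `|chi (shrink D s x)| = 1.
Proof. exact: character_norm. Qed.

Lemma shrink_charD s chi x y :
  chi (shrink D s (x + y)) = chi (shrink D s x) * chi (shrink D s y).
Proof. by rewrite shrinkD characterD. Qed.

Lemma shrink_char_continuous s chi :
  continuous ((fun x => chi (shrink D s x)) : G -> R[i]^o).
Proof.
move=> x; apply: (@continuous_comp G G R[i]^o (shrink D s) chi).
  exact: shrink_continuous.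
exact: character_continuous.
Qed.

Definition shrink_char s chi : character R G := Character
  (@shrink_norm s chi) (@shrink_charD s chi) (@shrink_char_continuous s chi).

Lemma characterB_val chi psi x : (chi - psi) x = chi x * (psi x)^*%C.
Proof. by []. Qed.

Lemma character_conjN chi x : (chi x)^*%C = chi (- x).
Proof.
have e : chi x * chi (- x) = chi x * (chi x)^*%C.
  by rewrite -characterD subrr character0 -sqr_normc character_norm expr1n.
have x0 : chi x != 0 by rewrite -normr_gt0 character_norm ltr01.
by apply: (mulfI x0).
Qed.

(** Large frequencies are those that oscillate on small boxes. *)
Definition dual_exhaustion n := polar (n.+1)%:R^-1.

(** [shrink_char] divides the frequency: it sends the polar of the box of
radius 1 / (n + 2) into the polar of the unit box, and what remains is in the
polar of the box of radius 1 / (n + 1). *)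
Lemma dual_exhaustion_step n : dual_exhaustion n.+1 `<=`
  [set chi + psi | chi in dual_exhaustion n & psi in dual_exhaustion 0].
Proof.
move=> chi pchi; set s : R := n.+2%:R^-1.
have s0 : 0 < s by rewrite invr_gt0.
have s1 : s <= 1 by rewrite invf_le1 ?ler1n.
exists (chi - shrink_char s chi).
  move=> x [xb Hx]; rewrite characterB_val character_conjN -characterD.
  apply: pchi; split.
    move=> j; rewrite crdD crd_shrink crdN mulrN -{1}[crd x j]mul1r -mulrBl normrM.
    rewrite ger0_norm ?subr_ge0//.
    apply: (@le_trans _ _ ((1 - s) * n.+1%:R^-1)); first by rewrite ler_wpM2l ?subr_ge0.
    have n1 : (0 : R) < n.+1%:R by rewrite ltr0n.
    suff -> : (1 - s) * n.+1%:R^-1 = s by [].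
    rewrite /s -[n.+2%:R]natr1; field.
    by rewrite !gt_eqF// addr_gt0.
  by apply: kernel_partD => //; exact: kernel_part_shrink.
exists (shrink_char s chi); last by rewrite subrK.
move=> x [xb _]; apply: pchi; split; last exact: kernel_part_shrink.
move=> j; rewrite crd_shrink normrM ger0_norm ?(ltW s0)// ler_piMr ?(ltW s0)//.
by rewrite (le_trans (xb j))// invr1.
Qed.

(** An ultrafilter has only to cluster in a compact set in order to converge. *)
Lemma ultra_bounded_cvg (T : Type) (F : set_system T) (f : T -> R) :
  UltraFilter F -> F [set x | -1 <= f x <= 1] -> exists l : R, f @ F --> l.
Proof.
move=> UF Ff; have PF : ProperFilter F by exact: ultra_proper.
have [|l [_ cl]] := @segment_compact R (-1) 1 (f @ F).
  have h : F (f @^-1` `[-1, 1]%classic); last exact: h.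
  by apply: (filterS _ Ff) => x /= fx; rewrite in_itv.
exists l => U nU; have [//|FU] := in_ultra_setVsetC (f @^-1` U) UF.
have {}FU : (f @ F) (~` U) by exact: FU.
by have [y [Uy nUy]] := cl _ _ FU nU.
Qed.

(** The Ascoli theorem for characters: pointwise limits along an ultrafilter
exist, are unitary and multiplicative, inherit the common modulus of continuity
of [polar_small], and this modulus makes the convergence uniform on compact
sets. *)
Lemma polar_compact t : 0 < t -> compact (polar t).
Proof.
move=> t0; rewrite compact_ultra => F UF Fpolar.
have PF : ProperFilter F by exact: ultra_proper.
have le1 (a b : R) : a ^+ 2 + b ^+ 2 = 1 -> -1 <= a <= 1.
  move=> ab; rewrite -ler_norml -(@expr_le1 _ 2)// real_normK ?num_real//.
  by rewrite -ab lerDl sqr_ge0.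
pose re x (chi : character R G) := complex.Re (chi x).
pose im x (chi : character R G) := complex.Im (chi x).
have re_im x chi : re x chi ^+ 2 + im x chi ^+ 2 = 1.
  by rewrite -normc_sqr normc_character expr1n.
have /choice[a ca] : forall x, exists l : R, re x @ F --> l.
  move=> x; apply: (ultra_bounded_cvg UF); apply: (filterS _ Fpolar) => chi _ /=.
  exact: le1 (re_im x chi).
have /choice[b cb] : forall x, exists l : R, im x @ F --> l.
  move=> x; apply: (ultra_bounded_cvg UF); apply: (filterS _ Fpolar) => chi _ /=.
  by have := re_im x chi; rewrite addrC; exact: le1.
have cvg2 (f : character R G -> R) (l : R) : f @ F --> l -> f \* f @ F --> l ^+ 2.
  by move=> h; rewrite expr2; exact: cvgM.
pose g x := (a x +i* b x)%C.
have g1 x : normc (g x) = 1.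
  apply/eqP; rewrite -sqrp_eq1 ?normc_ge0// normc_sqr /=; apply/eqP.
  have c : (re x \* re x) \+ (im x \* im x) @ F --> a x ^+ 2 + b x ^+ 2.
    by apply: (cvgD (cvg2 _ _ (ca x)) (cvg2 _ _ (cb x))).
  have e : (re x \* re x) \+ (im x \* im x) = cst 1.
    by apply/funext => chi /=; rewrite -!expr2 re_im.
  by rewrite e in c; rewrite -(cvg_lim (@Rhausdorff R) c); exact: lim_cst.
have gD x y : g (x + y) = g x * g y.
  have cr : (re x \* re y) \- (im x \* im y) @ F --> a x * a y - b x * b y.
    exact: (cvgB (cvgM (ca x) (ca y)) (cvgM (cb x) (cb y))).
  have ci : (re x \* im y) \+ (im x \* re y) @ F --> a x * b y + b x * a y.
    exact: (cvgD (cvgM (ca x) (cb y)) (cvgM (cb x) (ca y))).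
  have er : re (x + y) = (re x \* re y) \- (im x \* im y).
    by apply/funext => chi; rewrite /re /im /= characterD; case: (chi x) (chi y) => [? ?] [].
  have ei : im (x + y) = (re x \* im y) \+ (im x \* re y).
    by apply/funext => chi; rewrite /re /im /= characterD; case: (chi x) (chi y) => [? ?] [].
  rewrite /g /=; congr (_ +i* _)%C.
    by rewrite -(cvg_lim (@Rhausdorff R) cr) -(cvg_lim (@Rhausdorff R) (ca (x + y))) er.
  by rewrite -(cvg_lim (@Rhausdorff R) ci) -(cvg_lim (@Rhausdorff R) (cb (x + y))) ei.
have g_close x c : 0 <= c -> (forall chi, polar t chi -> normc (chi x - 1) <= c) ->
    normc (g x - 1) <= c.
  move=> c0 H; rewrite normc_le_sqr//.
  have cc : (fun chi => (re x chi - 1) * (re x chi - 1) + im x chi * im x chi) @ F -->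
      (a x - 1) ^+ 2 + b x ^+ 2.
    by apply: cvgD; apply: cvg2 => //; apply: cvgB => //; exact: cvg_cst.
  have -> : complex.Re (g x - 1) ^+ 2 + complex.Im (g x - 1) ^+ 2 =
      (a x - 1) ^+ 2 + b x ^+ 2 by rewrite /g /= subr0.
  rewrite -(cvg_lim _ cc)//; apply: limr_le; first exact: cvgP cc.
  apply: (filterS _ Fpolar) => chi /H; rewrite normc_le_sqr//.
  by rewrite /re /im -!expr2; case: (chi x) => ? ? /=; rewrite subr0.
have g_small k x : box D (t / 2 ^+ k) x -> normc (g x - 1) <= (2 / 3) ^+ k / 2.
  move=> xk; apply: g_close; first by rewrite divr_ge0// exprn_ge0// divr_ge0.
  by move=> chi pchi; exact: polar_small (ltW t0) pchi xk.
have g_norm x : `|g x| = 1 by rewrite normCE g1.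
pose gc := Character g_norm gD (unitary_continuous g1 gD t0 g_small).
exists gc; split.
  move=> x xt; apply: g_close => // chi; exact.
pose ev : character R G -> {compact-open, G -> R[i]^o} := @character_fun R G.
suff cF : {compact-open, ev @ F --> ev gc}.
  move=> U [_ [[C oC <-] Cab] CU]; apply: filterS CU _.
  by apply: cF; exact: open_nbhs_nbhs.
apply/(@compact_open_fam_compactP G R[i]^o); first exact: character_continuous.
apply/fam_cvgP => K cK P /uniform_nbhs [E [entE EP]]; apply: (filterS EP).
move: entE; rewrite -entourage_ballE => -[e /= e0 eE].
have [e1 e10 eE1] := gt0_complex_real e0.
have e14 : 0 < e1 / 4 by rewrite divr_gt0.
have [k hk] := two_thirds_expr_small e14.
have tk : 0 < t / 2 ^+ k by rewrite divr_gt0// exprn_gt0.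
have [||Z _ HZ] := @group_compact_cover G K cK _ setT
    (fun z => [set z + y | y in box D (t / 2 ^+ k)]^°).
- by move=> z _; exact: open_interior.
- by move=> z _; exists z => //; have := translate_nbhs z (box_nbhs0 D tk); rewrite addr0.
have near_pt z : F [set chi | normc (g z - chi z) < e1 / 2].
  have /cvgr_dist_lt/(_ _ e14) := ca z; have /cvgr_dist_lt/(_ _ e14) := cb z.
  apply: filterS2 => chi; rewrite /re /im => hi hr.
  suff: normc (g z - chi z) < e1 / 2 by [].
  move: hi hr; rewrite /g; case: (chi z) => r i hi hr; rewrite /= in hi hr.
  have -> : normc ((a z +i* b z)%C - (r +i* i)%C) =
      normc ((a z - r)%:C%C + (0 +i* (b z - i))%C).
    by congr normc; apply/eqP; rewrite eq_complex /= addr0 add0r !eqxx.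
  rewrite (le_lt_trans (le_normc_add _ _))// normcR.
  rewrite [normc (_ +i* _)%C]normc_sqrtE /= expr0n add0r sqrtr_sqr; lra.
have near_seq (r : seq G) :
    F [set chi | forall z, z \in r -> normc (g z - chi z) < e1 / 2].
  elim: r => [|z r IH]; first by apply: filterS filterT => chi _ z; rewrite in_nil.
  apply: filterS2 (near_pt z) IH => chi hz hr z'.
  by rewrite in_cons => /predU1P[->//|]; exact: hr.
apply: filterS2 Fpolar (near_seq (finmap.enum_fset Z)) => chi pchi Hchi y Ky; apply: eE => /=.
rewrite /ball /= /ball_ eE1 normCE ltcR.
have /HZ[z /= zZ /interior_subset[v vb vy]] := Ky.
have -> : g y - chi y = (g y - g z) + (g z - chi z) + (chi z - chi y) by ring.
have yz : y - z = v by rewrite -vy addrC addrA addNr add0r.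
have zy : z - y = - v by rewrite -yz opprB.
have h1 : normc (g y - g z) < e1 / 4.
  by rewrite (unitary_dist g1 gD) yz (le_lt_trans (g_small _ _ vb)).
have h2 : normc (chi z - chi y) < e1 / 4.
  rewrite (unitary_dist (normc_character chi) (@characterD R G chi)) zy.
  by rewrite (le_lt_trans (polar_small (ltW t0) pchi (boxN vb))).
rewrite (le_lt_trans (le_normc_add _ _))//.
have := le_normc_add (g y - g z) (g z - chi z).
have := Hchi z zZ; lra.
Qed.

End characters.

(** * Gaussians *)

Section gaussian.
Context {R : realType} {G : topologicalZmodType} (D : decomposition R G).
Implicit Types (x y z v : G) (c s t : R).

Definition box_exhaustion n : set G := box D n.+1%:R.

Lemma box_exhaustionP : exhaustion box_exhaustion.
Proof.
split; first exact: box_compact.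
  by move=> n; apply: box_le; rewrite ler_nat.
move=> n x [xb Hx]; set s : R := n.+2%:R^-1.
have s0 : 0 < s by rewrite invr_gt0.
have s1 : s <= 1 by rewrite invf_le1 ?ler1n.
exists (x - shrink D s x).
  split; last by apply: kernel_partB => //; exact: kernel_part_shrink.
  move=> j; rewrite crdD crdN crd_shrink -{1}[crd x j]mul1r -mulrBl normrM.
  rewrite ger0_norm ?subr_ge0//.
  apply: (@le_trans _ _ ((1 - s) * n.+2%:R)); first by rewrite ler_wpM2l ?subr_ge0.
  by rewrite mulrBl mul1r mulVf// -[n.+2%:R]natr1 addrK.
exists (shrink D s x); last by rewrite subrK.
split; last exact: kernel_part_shrink.
move=> j; rewrite crd_shrink normrM ger0_norm ?(ltW s0)//.
by rewrite (le_trans (ler_wpM2l (ltW s0) (xb j)))// mulVf.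
Qed.

Lemma dual_exhaustionP : exhaustion (@dual_exhaustion R G D).
Proof.
split; first by apply: polar_compact; rewrite invr1.
  by move=> n; apply: polar_le; rewrite lef_pV2 ?posrE// ler_nat.
exact: dual_exhaustion_step.
Qed.

(** The squared Euclidean norm of the R^a component. *)
Definition sqnorm x := \sum_(j < dec_dim D) crd x j ^+ 2.

Definition gauss c x := \1_(kernel_part D) x * expR (- c * sqnorm x).

Lemma sqnorm_ge0 x : 0 <= sqnorm x.
Proof. by apply: sumr_ge0 => j _; exact: sqr_ge0. Qed.

Lemma sqnorm_ge x (j : 'I_(dec_dim D)) : crd x j ^+ 2 <= sqnorm x.
Proof. by rewrite /sqnorm (bigD1 j)//= lerDl sumr_ge0// => i _; exact: sqr_ge0. Qed.

Lemma gauss_ge0 c x : 0 <= gauss c x.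
Proof. by rewrite mulr_ge0 ?expR_ge0. Qed.

Lemma gauss_out c x : ~ kernel_part D x -> gauss c x = 0.
Proof. by move=> Hx; rewrite /gauss indicE memNset// mul0r. Qed.

Lemma gauss_in c x : kernel_part D x -> gauss c x = expR (- c * sqnorm x).
Proof. by move=> Hx; rewrite /gauss indicE mem_set// mul1r. Qed.

Lemma gauss_le1 c x : 0 <= c -> gauss c x <= 1.
Proof.
move=> c0; have [Hx|Hx] := pselect (kernel_part D x); last by rewrite gauss_out.
by rewrite gauss_in// -expR0 ler_expR mulNr oppr_le0 mulr_ge0// sqnorm_ge0.
Qed.

Lemma gauss_le_out c t x : 0 <= c -> 0 <= t -> ~ box D t x ->
  gauss c x <= expR (- c * t ^+ 2).
Proof.
move=> c0 t0 nx; have [Hx|Hx] := pselect (kernel_part D x); last first.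
  by rewrite gauss_out// expR_ge0.
rewrite gauss_in// ler_expR !mulNr lerN2 ler_wpM2l//.
have [j tj] : exists j : 'I_(dec_dim D), t < `|crd x j|.
  apply: contrapT => /forallNP h; apply: nx; split => // j.
  by rewrite leNgt; apply/negP; exact: h.
apply: le_trans (sqnorm_ge x j).
by rewrite -[leRHS]real_normK ?num_real// lerXn2r ?nnegrE// ltW.
Qed.

Lemma gauss_ge_box1 c x : 0 <= c -> box D 1 x ->
  expR (- c * (dec_dim D)%:R) <= gauss c x.
Proof.
move=> c0 [xb Hx]; rewrite gauss_in// ler_expR !mulNr lerN2 ler_wpM2l//.
apply: (@le_trans _ _ (\sum_(j < dec_dim D) 1)); last first.
  by rewrite sumr_const card_ord.
apply: ler_sum => j _; rewrite -[leLHS]real_normK ?num_real//.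
by rewrite exprn_ile1.
Qed.

Lemma gaussD c d x : gauss (c + d) x = gauss c x * gauss d x.
Proof.
have [Hx|Hx] := pselect (kernel_part D x); last by rewrite !gauss_out ?mul0r.
by rewrite !gauss_in// -expRD opprD mulrDl.
Qed.

Lemma measurable_gauss c : measurable_fun [set: borel G] (gauss c : borel G -> R).
Proof.
apply: measurable_funM.
  apply: measurable_indic; apply: borel_open; exact: kernel_part_open.
apply: (@measurableT_comp _ _ _ _ _ _ (@expR R)) => //.
apply: measurable_funM => //.
apply: measurable_sum => j; apply: measurable_funX.
by apply: continuous_borel_fun; exact: crd_continuous.
Qed.

(** Off the box of radius [n + 1] the Gaussian is at most the power [n + 1] of
[expR (- c * n.+1%:R)], a base that becomes smaller than any rate. *)
Lemma gauss_fast_decay c : 0 < c -> fast_decay box_exhaustion (gauss c).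
Proof.
move=> c0; split.
  by exists 1 => x; rewrite ger0_norm ?gauss_ge0// gauss_le1// ltW.
move=> e e0.
pose e1 := Num.min e 1.
have e10 : 0 < e1 by rewrite lt_min e0 ltr01.
have e11 : e1 <= 1 by rewrite ge_min lexx orbT.
have [N HN] : exists N : nat, expR (- c * N.+1%:R) <= e1.
  pose N := Num.trunc (- ln e1 / c); exists N.
  rewrite -[leRHS]lnK ?posrE// ler_expR mulNr lerNl mulrC -ler_pdivrMr//.
  by rewrite ltW// truncnS_gt.
exists (e1 ^- N) => x n nx.
rewrite ger0_norm ?gauss_ge0//.
apply: (@le_trans _ _ (e1 ^- N * e1 ^+ n)); last first.
  rewrite ler_wpM2l ?invr_ge0 ?exprn_ge0 ?(ltW e10)//.
  by rewrite lerXn2r ?nnegrE ?(ltW e0) ?(ltW e10)// ge_min lexx.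
rewrite mulrC ler_pdivlMr ?exprn_gt0//.
have [nN|Nn] := ltnP n N.
  apply: (@le_trans _ _ (e1 ^+ N)).
    by rewrite ler_piMl ?gauss_le1 ?exprn_ge0 ?(ltW e10) ?(ltW c0).
  by apply: ler_wiXn2l => //; [exact: ltW|exact: ltnW].
apply: (@le_trans _ _ (gauss c x)).
  by rewrite ler_piMr ?gauss_ge0 ?exprn_ile1 ?(ltW e10).
apply: (le_trans (gauss_le_out (ltW c0) _ nx)) => //.
have -> : - c * n.+1%:R ^+ 2 = (- c * n.+1%:R) * n.+1%:R by rewrite expr2 mulrA.
rewrite expRM_natr.
apply: (@le_trans _ _ (e1 ^+ n.+1)); last by apply: ler_wiXn2l => //; exact: ltW.
rewrite lerXn2r ?nnegrE ?expR_ge0 ?(ltW e10)// (le_trans _ HN)// ler_expR.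
by rewrite !mulNr lerN2 ler_wpM2l ?(ltW c0)// ler_nat.
Qed.

End gaussian.

Section integrable.
Context {R : realType} {G : topologicalZmodType} (D : decomposition R G).
Variable mu : {measure set (borel G) -> \bar R}.
Hypothesis mu_haar : normalized_haar D mu.
Implicit Types (x y z v : G) (c s t : R).
Local Notation K := (box_exhaustion D).

Lemma box_measure_growth : exists C m : R, [/\ 0 <= C, 1 <= m &
  forall n, (mu (K n) <= (C * m ^+ n)%:E)%E].
Proof.
have [m Hm] := exhaustion_cover D (box_exhaustionP D).
have bfin := haar_box_fin mu_haar 1; set b := fine (mu (box D 1)).
have b0 : (0 <= b)%R by rewrite fine_ge0.
exists (m.+1%:R * b), m.+1%:R; split; [by rewrite mulr_ge0|by rewrite ler1n|].
move=> n; have [Z sZ HZ] := Hm n.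
apply: (@le_trans _ _ ((size Z)%:R%:E * mu (box D 1))%E).
  apply: (@cover_by_measure _ _ _ _ mu_haar 0).
    by apply: (borel_compact D); exact: box_compact.
  move=> x Kx; exists x; last by rewrite add0r.
  by apply: HZ; exists x => //; exists 0; rewrite ?addr0//; exact: box0.
rewrite -(fineK bfin) -/b -EFinM lee_fin mulrAC -exprS ler_wpM2r//.
by rewrite -natrX ler_nat (leq_trans sZ)// leq_exp2r.
Qed.

Lemma bigcup_box : \bigcup_n K n = kernel_part D.
Proof.
apply/seteqP; split => [x [n _ []]//|x Hx].
exists (Num.trunc (Num.sqrt (sqnorm D x))) => //; split=> // j.
apply: (@le_trans _ _ (Num.sqrt (sqnorm D x))); last by rewrite ltW// truncnS_gt.
by rewrite -sqrtr_sqr ler_wsqrtr// sqnorm_ge.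
Qed.

(** Decay beats the exponential growth of the measures of the boxes. *)
Lemma gauss_integrable c : 0 < c ->
  mu.-integrable [set: borel G] (EFin \o (gauss D c : borel G -> R)).
Proof.
move=> c0; have mg := measurable_gauss D c.
apply/integrableP; split; first exact/measurable_EFinP.
have [C [m [C0 m1 HC]]] := box_measure_growth.
have m0 : 0 < m by exact: lt_le_trans m1.
pose e := (2 * m)^-1.
have e0 : 0 < e by rewrite invr_gt0 mulr_gt0.
have [[B HB] /(_ e e0)[A HA]] := gauss_fast_decay D c0.
pose A1 := Num.max `|B| (`|A| / e).
have A10 : 0 <= A1 by rewrite le_max normr_ge0.
pose F := seqDU (fun n => K n : set (borel G)).
have mK n : measurable (K n : set (borel G)).
  by apply: (borel_compact D); exact: box_compact.
have mF n : measurable (F n).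
  by apply: measurableD => //; apply: bigsetU_measurable => i _; exact: mK.
have gF n x : F n x -> gauss D c x <= A1 * e ^+ n.
  have gx := gauss_ge0 D c x; case: n => [|n] [Kx nKx].
    rewrite expr0 mulr1 le_max; apply/orP; left.
    by have := HB x; rewrite ger0_norm// => /le_trans; apply; exact: ler_norm.
  have := HA x n; rewrite ger0_norm// => h.
  have /h/le_trans : ~ K n x.
    by move=> Knx; apply: nKx; rewrite -bigcup_mkord; exists n => //=.
  apply; rewrite exprS mulrA; apply: ler_wpM2r; first by rewrite exprn_ge0 ?ltW.
  by rewrite (le_trans (ler_norm A))// -ler_pdivrMr// le_max lexx orbT.
have -> : (\int[mu]_x `|(EFin \o (gauss D c : borel G -> R)) x|)%E =
    (\int[mu]_(x in \bigcup_n F n) (gauss D c x)%:E)%E.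
  rewrite -seqDU_bigcup_eq bigcup_box [RHS]integral_mkcond.
  apply: eq_integral => x _; rewrite /= ger0_norm ?gauss_ge0// patchE.
  by case: ifPn => // /negP; rewrite inE => nx; rewrite gauss_out.
rewrite ge0_integral_bigcup//; last 3 first.
- by apply/measurable_EFinP; exact: measurable_funS mg.
- by move=> x _; rewrite lee_fin gauss_ge0.
- exact: trivIset_seqDU.
pose b n := (A1 * C) * 2^-1 ^+ n.
apply: (@le_lt_trans _ _ (\sum_(0 <= n <oo) (b n)%:E)%E).
  apply: lee_nneseries => [n _ _|n _].
    by apply: integral_ge0 => x _; rewrite lee_fin gauss_ge0.
  apply: (@le_trans _ _ (\int[mu]_(x in F n) cst (A1 * e ^+ n)%:E x)%E).
    apply: ge0_le_integral => //.
    - by move=> x _; rewrite lee_fin gauss_ge0.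
    - by apply/measurable_EFinP; exact: measurable_funS mg.
    - by move=> x Fx; rewrite lee_fin gF.
  rewrite integral_cst//.
  apply: (@le_trans _ _ ((A1 * e ^+ n)%:E * (C * m ^+ n)%:E)%E).
    rewrite lee_wpmul2l// ?lee_fin ?mulr_ge0 ?exprn_ge0 ?(ltW e0)//.
    apply: le_trans (HC n); apply: le_measure; rewrite ?inE//; exact: subDsetl.
  rewrite -EFinM lee_fin /b /e !exprVn exprMn le_eqVlt; apply/orP; left; apply/eqP.
  by field; rewrite !expf_neq0 ?gt_eqF.
apply: (@le_lt_trans _ _ (A1 * C * 2)%:E); last exact: ltry.
apply: lime_le.
  by apply: is_cvg_nneseries => n _ _; rewrite lee_fin !mulr_ge0 ?exprn_ge0.
apply: nearW => n; rewrite sumEFin lee_fin.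
have AC : 0 <= A1 * C by exact: mulr_ge0.
have := @geometric_le_lim R n (A1 * C) 2^-1 AC.
rewrite invr_gt0 ltr0n ger0_norm// invf_lt1// ltr1n => /(_ isT isT).
by rewrite (_ : A1 * C / (1 - 2^-1) = A1 * C * 2 :> R)%R; last by field.
Qed.

End integrable.

(** * The Fourier transform and translations *)

Section fourier.
Context {R : realType} {G : topologicalZmodType} (D : decomposition R G).
Variable mu : {measure set (borel G) -> \bar R}.
Hypothesis mu_haar : normalized_haar D mu.
Implicit Types (x y v : G) (c s t : R) (u : G -> R) (chi psi : character R G).
Local Notation integrable u := (mu.-integrable [set: borel G] (EFin \o (u : borel G -> R))).

Lemma Re_le_normc (z : R[i]) : `|complex.Re z| <= normc z.
Proof. by rewrite normc_sqrtE -sqrtr_sqr ler_wsqrtr// lerDl sqr_ge0. Qed.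

Lemma Im_le_normc (z : R[i]) : `|complex.Im z| <= normc z.
Proof. by rewrite normc_sqrtE -sqrtr_sqr ler_wsqrtr// lerDr sqr_ge0. Qed.

Lemma normc_le_Re_Im (z : R[i]) : normc z <= `|complex.Re z| + `|complex.Im z|.
Proof.
rewrite normc_le_sqr ?addr_ge0//; case: z => a b /=.
rewrite -[a ^+ 2]real_normK ?num_real// -[b ^+ 2]real_normK ?num_real//.
by have := normr_ge0 a; have := normr_ge0 b; nra.
Qed.

(** [part] stands for the real or the imaginary part. *)
Lemma character_part_continuous (part : R[i] -> R) chi :
  (forall z1 z2 : R[i], part (z1 - z2) = part z1 - part z2) ->
  (forall z, `|part z| <= normc z) ->
  continuous (fun x => part (chi x)).
Proof.
move=> pB ple x; apply/cvgrPdist_lt => e e0.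
have /(@cvgrPdist_lt R[i] R[i]^o G (nbhs x))/(_ e%:C%C) := @character_continuous R G chi x.
rewrite ltcR => /(_ e0); apply: filterS => y; rewrite normCE ltcR => h.
by rewrite -pB (le_lt_trans (ple _)).
Qed.

Lemma ReB (z1 z2 : R[i]) : complex.Re (z1 - z2) = complex.Re z1 - complex.Re z2.
Proof. by case: z1 z2 => [? ?] []. Qed.

Lemma ImB (z1 z2 : R[i]) : complex.Im (z1 - z2) = complex.Im z1 - complex.Im z2.
Proof. by case: z1 z2 => [? ?] []. Qed.

Lemma Re_character_le1 chi x : `|complex.Re (chi x)| <= 1.
Proof. by rewrite -(normc_character chi x) Re_le_normc. Qed.

Lemma Im_character_le1 chi x : `|complex.Im (chi x)| <= 1.
Proof. by rewrite -(normc_character chi x) Im_le_normc. Qed.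

Lemma integrableM u (h : G -> R) : integrable u ->
  measurable_fun [set: borel G] (h : borel G -> R) -> (forall x, `|h x| <= 1) ->
  integrable (fun x => u x * h x).
Proof.
move=> iu mh h1; have /measurable_int/measurable_EFinP mu' := iu.
apply: le_integrable iu => //.
  by apply/measurable_EFinP; exact: measurable_funM.
by move=> x _ /=; rewrite lee_fin normrM ler_piMr.
Qed.

Lemma integrable_Re u chi : integrable u -> integrable (fun x => u x * complex.Re (chi x)).
Proof.
move=> iu; apply: integrableM => //; last exact: Re_character_le1.
apply: continuous_borel_fun; apply: character_part_continuous => *.
  exact: ReB.
exact: Re_le_normc.
Qed.

Lemma integrable_Im u chi : integrable u -> integrable (fun x => u x * complex.Im (chi x)).
Proof.
move=> iu; apply: integrableM => //; last exact: Im_character_le1.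
apply: continuous_borel_fun; apply: character_part_continuous => *.
  exact: ImB.
exact: Im_le_normc.
Qed.

Definition fourierR u chi := fourier mu (fun x => (u x)%:C%C) chi.

Lemma fourierRE u chi : integrable u -> fourierR u chi =
  ((\int[mu]_x (u x * complex.Re (chi x))) +i*
   (- \int[mu]_x (u x * complex.Im (chi x))))%C.
Proof.
move=> iu; rewrite /fourierR /fourier; congr (_ +i* _)%C.
  by apply: eq_Rintegral => x _ /=; case: (chi x) => a b /=; rewrite mul0r subr0.
rewrite -mulN1r -RintegralZl//; last exact: integrable_Im.
by apply: eq_Rintegral => x _ /=; case: (chi x) => a b /=; rewrite mul0r addr0 mulN1r mulrN.
Qed.

Lemma fourierR_bound u g chi B : integrable u -> integrable g ->
  (forall x, `|u x| <= B * g x) ->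
  normc (fourierR u chi) <= 2 * (B * \int[mu]_x g x).
Proof.
move=> iu ig ug; rewrite fourierRE// (le_trans (normc_le_Re_Im _))//= normrN.
rewrite mulr2n mulrDl mul1r -RintegralZl//.
have iBg : integrable (fun x => B * g x).
  by have := integrableZl measurableT B ig; apply: eq_integrable.
have key (h : G -> R) : integrable (fun x => u x * h x) -> (forall x, `|h x| <= 1) ->
    `|\int[mu]_x (u x * h x)| <= \int[mu]_x (B * g x).
  move=> iuh h1; apply: (le_trans (le_normr_Rintegral _ _)) => //.
  apply: le_Rintegral => //; first exact: integrable_norm.
  move=> x _; rewrite normrM (le_trans _ (ug x))// ler_piMr//.
apply: lerD; apply: key.
- exact: integrable_Re.
- exact: Re_character_le1.
- exact: integrable_Im.
- exact: Im_character_le1.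
Qed.

Lemma fourierRB u1 u2 chi : integrable u1 -> integrable u2 ->
  fourierR (fun x => u1 x - u2 x) chi = fourierR u1 chi - fourierR u2 chi.
Proof.
move=> i1 i2; have i12 : integrable (fun x => u1 x - u2 x).
  by have := integrableB measurableT i1 i2; apply: eq_integrable.
rewrite !fourierRE//.
apply/eqP; rewrite eq_complex /=; apply/andP; split; apply/eqP.
  rewrite -RintegralB//; [|exact: integrable_Re..].
  by apply: eq_Rintegral => x _; rewrite mulrBl.
rewrite -opprD -RintegralB//; [|exact: integrable_Im..].
by congr (- _); apply: eq_Rintegral => x _; rewrite mulrBl.
Qed.

Lemma fourierR_translate u v chi : integrable u ->
  fourierR (fun x => u (x - v)) chi = (chi v)^*%C * fourierR u chi.
Proof.
move=> iu; have iuv : integrable (fun x => u (x - v)) by exact: (integrable_translate mu_haar).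
have iR := integrable_Re chi iu; have iI := integrable_Im chi iu.
rewrite !fourierRE//; case E : (chi v) => [a b].
have Hre x : complex.Re (chi (x + v)) = complex.Re (chi x) * a - complex.Im (chi x) * b.
  by rewrite characterD E; case: (chi x).
have Him x : complex.Im (chi (x + v)) = complex.Re (chi x) * b + complex.Im (chi x) * a.
  by rewrite characterD E; case: (chi x).
have shift (h : G -> R) : integrable (fun x => u (x - v) * h x) ->
    \int[mu]_x (u (x - v) * h x) = \int[mu]_x (u x * h (x + v)).
  move=> ih; rewrite -(Rintegral_translate mu_haar v ih).
  by apply: eq_Rintegral => x _; rewrite addrK.
have iz (r : R) (h : G -> R) : integrable h -> integrable (fun x => r * h x).
  by move=> ih; have := integrableZl measurableT r ih; apply: eq_integrable.
apply/eqP; rewrite eq_complex /=; apply/andP; split; apply/eqP.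
  rewrite shift; last exact: integrable_Re.
  rewrite mulrNN -!RintegralZl// -RintegralB//; [|exact: iz..].
  by apply: eq_Rintegral => x _; rewrite Hre; ring.
rewrite shift; last exact: integrable_Im.
rewrite mulrN mulNr -opprD -!RintegralZl// -RintegralD//; [|exact: iz..].
by congr (- _); apply: eq_Rintegral => x _; rewrite Him; ring.
Qed.

(** Differences of a function become multiplication of its transform by
1 - conj (chi v), which is bounded away from zero when [chi] oscillates along
[v]. *)
Definition gdiff v u x := u x - u (x - v).

Lemma integrable_gdiff n v u : integrable u -> integrable (iter n (gdiff v) u).
Proof.
move=> iu; elim: n => [//|n IH]; rewrite iterS.
have i2 : integrable (fun x => iter n (gdiff v) u (x - v)).
  exact: (integrable_translate mu_haar).
by have := integrableB measurableT IH i2; apply: eq_integrable.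
Qed.

Lemma fourierR_gdiff n v u chi : integrable u ->
  fourierR (iter n (gdiff v) u) chi = (1 - (chi v)^*%C) ^+ n * fourierR u chi.
Proof.
move=> iu; elim: n => [|n IH]; first by rewrite expr0 mul1r.
have iun := integrable_gdiff n v iu.
rewrite iterS fourierRB//; last exact: (integrable_translate mu_haar).
by rewrite fourierR_translate// IH exprS; ring.
Qed.

Lemma fourierR_gdiff_normc n v u chi : integrable u ->
  normc (fourierR (iter n (gdiff v) u) chi) =
  normc (chi v - 1) ^+ n * normc (fourierR u chi).
Proof.
move=> iu; rewrite fourierR_gdiff// normcM.
have -> : normc (chi v - 1) = normc (1 - (chi v)^*%C).
  by rewrite -normc_conj rmorphB rmorph1 normc_sub.
congr (_ * _); elim: n => [|n IH]; first by rewrite !expr0 normc1.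
by rewrite !exprS normcM IH.
Qed.

End fourier.

(** * Decay and continuity of the Fourier transform of the Gaussian *)

Section gaussian_fourier.
Context {R : realType} {G : topologicalZmodType} (D : decomposition R G).
Variable mu : {measure set (borel G) -> \bar R}.
Hypothesis mu_haar : normalized_haar D mu.
Implicit Types (x y v : G) (c s t : R) (chi psi : character R G).

Definition axis (j : 'I_(dec_dim D)) s : G := @dec_inv _ _ D (s *: delta_mx ord0 j, 0).

Lemma axisD j s t : axis j (s + t) = axis j s + axis j t.
Proof. by rewrite -dec_invD /axis scalerDl; congr (@dec_inv _ _ D (_, _)); rewrite addr0. Qed.

Lemma axis0 j : axis j 0 = 0.
Proof. by apply: (@addrI _ (axis j 0)); rewrite -axisD !addr0. Qed.

Lemma crd_axis j s i : crd (axis j s) i = s * (i == j)%:R.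
Proof. by rewrite crd_inv /= !mxE eqxx. Qed.

Lemma kernel_part_axis j s : kernel_part D (axis j s).
Proof. by rewrite /kernel_part/= dec_invK; exact: dec_subgroup0. Qed.

Lemma sqnorm_axis x j u :
  sqnorm D (x - axis j u) = sqnorm D x - (2 * crd x j * u - u ^+ 2).
Proof.
rewrite /sqnorm (bigD1 j)//= [in RHS](bigD1 j)//= crdD crdN crd_axis eqxx mulr1.
rewrite (eq_bigr (fun i => crd x i ^+ 2)); last first.
  by move=> i ij; rewrite crdD crdN crd_axis (negbTE ij) mulr0 subr0.
ring.
Qed.

Lemma gauss_axis x j u :
  gauss D 1 (x - axis j u) = gauss D 1 x * expR (2 * crd x j * u - u ^+ 2).
Proof.
have [Hx|Hx] := pselect (kernel_part D x); last first.
  rewrite !gauss_out ?mul0r// => Hxu; apply: Hx.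
  by rewrite -(subrK (axis j u) x); apply: kernel_partD => //; exact: kernel_part_axis.
rewrite !gauss_in//; last by apply: kernel_partB => //; exact: kernel_part_axis.
by rewrite -expRD sqnorm_axis; congr expR; ring.
Qed.

Lemma iter_gdiff_gauss n s j x u :
  iter n (gdiff (axis j s)) (gauss D 1) (x - axis j u) =
  gauss D 1 x * iter n (fdiff s) (fun u => expR (2 * crd x j * u - u ^+ 2)) u.
Proof.
elim: n u => [|n IH] u; first exact: gauss_axis.
by rewrite !iterS /gdiff -addrA -opprD -axisD !IH mulrBr.
Qed.

(** The exponential loss [expR (2 * `|crd x j| * rho)] of the one-dimensional
estimate is absorbed by half of the Gaussian. *)
Lemma iter_gdiff_gauss_bound n s j rho x : 0 < rho -> n%:R * `|s| <= rho ->
  `|iter n (gdiff (axis j s)) (gauss D 1) x| <=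
  (2 * (n%:R * `|s|) / rho) ^+ n * expR (3 * rho ^+ 2) * gauss D 2^-1 x.
Proof.
move=> r0 nsr; rewrite -{1}[x]subr0 -(axis0 j) iter_gdiff_gauss normrM.
rewrite ger0_norm ?gauss_ge0//.
have e0 : 0 <= (2 * (n%:R * `|s|) / rho) ^+ n.
  by rewrite exprn_ge0// divr_ge0 ?(ltW r0)// mulr_ge0// mulr_ge0.
have [Hx|Hx] := pselect (kernel_part D x); last by rewrite !gauss_out// mul0r mulr0.
rewrite !gauss_in// mulrC -mulrA.
apply: (@le_trans _ _ ((2 * (n%:R * `|s|) / rho) ^+ n *
    expR (`|2 * crd x j| * rho + rho ^+ 2) * expR (- 1 * sqnorm D x))).
  by rewrite ler_wpM2r ?expR_ge0// iter_fdiff_gauss.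
rewrite -mulrA ler_wpM2l// -!expRD ler_expR normrM ger0_norm//.
have := sqnorm_ge x j; rewrite -[crd x j ^+ 2]real_normK ?num_real//.
have := sqr_ge0 (`|crd x j| - 2 * rho); nra.
Qed.

Lemma unitary_dist1_sum chi (r : seq 'I_(dec_dim D)) (a : 'I_(dec_dim D) -> R) :
  normc (chi (\sum_(j <- r) axis j (a j)) - 1) <=
  \sum_(j <- r) normc (chi (axis j (a j)) - 1).
Proof.
elim: r => [|j r IH]; first by rewrite !big_nil character0 subrr ComplexField.Normc.normc0.
rewrite !big_cons.
apply: (le_trans (unitary_dist1D (normc_character chi) (@characterD R G chi) _ _)).
by rewrite lerD.
Qed.

Lemma shrink1_sum x : shrink D 1 x = \sum_j axis j (crd x j).
Proof.
have inv_sum (r : seq 'I_(dec_dim D)) (a : 'I_(dec_dim D) -> 'rV[R]_(dec_dim D)) :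
    @dec_inv _ _ D (\sum_(j <- r) a j, 0) = \sum_(j <- r) @dec_inv _ _ D (a j, 0).
  elim: r => [|j r IH].
    by rewrite !big_nil; apply: (can_inj (@dec_isoK _ _ D)); rewrite dec_invK dec_iso0.
  rewrite !big_cons -IH -dec_invD; congr (@dec_inv _ _ D _).
  by congr (_, _); rewrite addr0.
by rewrite /shrink scale1r {1}[(dec_iso D x).1]row_sum_delta inv_sum.
Qed.

Local Notation hat := (fourierR mu (gauss D 1)).

(** The Gaussian is invariant under translation by [h], so its transform is
unchanged by multiplication by [chi h]. *)
Lemma fourier_gauss_trivial chi h : kernel_part D h -> (forall j, crd (D:=D) h j = 0) ->
  chi h != 1 -> hat chi = 0.
Proof.
move=> Hh h0 chih.
have ig := gauss_integrable mu_haar ltr01.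
have := fourierR_gdiff_normc mu_haar 1 h chi ig.
have : normc (fourierR mu (iter 1 (gdiff h) (gauss D 1)) chi) <=
    2 * (0 * (\int[mu]_x gauss D 1 x)).
  apply: fourierR_bound => //; first exact: (integrable_gdiff mu_haar).
  move=> x /=; rewrite mul0r /gdiff.
  have -> : gauss D 1 (x - h) = gauss D 1 x.
    have [Hx|Hx] := pselect (kernel_part D x).
      rewrite !gauss_in//; last exact: kernel_partB.
      congr (expR (_ * _)); apply: eq_bigr => j _.
      by rewrite crdD crdN h0 subr0.
    rewrite !gauss_out// => Hxh; apply: Hx.
    by rewrite -(subrK h x); exact: kernel_partD.
  by rewrite subrr normr0.
rewrite mul0r mulr0 => le0 e.
have /eqP : normc (chi h - 1) ^+ 1 * normc (hat chi) = 0.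
  by apply/eqP; rewrite eq_le -e le0 normc_ge0.
rewrite expr1 mulf_eq0 => /orP[] /eqP /ComplexField.Normc.eq0_normc // /eqP.
by rewrite subr_eq0 (negbTE chih).
Qed.

Lemma fourier_gauss_axis chi m j s rho : 0 < rho -> m%:R * `|s| <= rho ->
  normc (chi (axis j s) - 1) ^+ m * normc (hat chi) <=
  (2 * (m%:R * `|s|) / rho) ^+ m * (2 * expR (3 * rho ^+ 2) * \int[mu]_x gauss D 2^-1 x).
Proof.
move=> r0 msr; have ig := gauss_integrable mu_haar ltr01.
have h0 : 0 < 2^-1 :> R by rewrite invr_gt0.
rewrite -(fourierR_gdiff_normc mu_haar)//.
have := @fourierR_bound _ _ mu _ (gauss D 2^-1) chi _
  (integrable_gdiff mu_haar m (axis j s) ig) (gauss_integrable mu_haar h0)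
  (fun x => iter_gdiff_gauss_bound j x r0 msr).
by move=> /le_trans; apply; rewrite le_eqVlt; apply/orP; left; apply/eqP; ring.
Qed.

(** A character outside the polar of the box of radius 1 / (n + 1) is either
nontrivial on the compact subgroup, and then the transform vanishes, or moves away
from 1 by more than a constant [kap] along one axis, at a step [s] of size at most
1 / (n + 1).  Taking [m] proportional to [n + 1] differences with this step keeps
[m * s] bounded, and the constant [rho], which may be as large as the wanted rate
requires, turns the estimate into the power [m] of 1/2. *)
Lemma fourier_gauss_fast_decay :
  fast_decay (dual_exhaustion D) (fun chi => normc (hat chi)).
Proof.
have ig := gauss_integrable mu_haar ltr01.
split.
  exists (2 * (1 * \int[mu]_x gauss D 1 x)) => chi.
  rewrite ger0_norm ?normc_ge0//; apply: fourierR_bound => // x.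
  by rewrite mul1r ger0_norm// gauss_ge0.
move=> e e0; pose kap : R := (2 * (dec_dim D).+1%:R)^-1.
have kap0 : 0 < kap by rewrite invr_gt0 mulr_gt0.
have kap1 : kap <= 1 by rewrite invf_le1 ?mulr_gt0// -natrM ler1n.
have [k /= ke] : exists k : nat, 2^-1 ^+ k.+1 <= e.
  have : 2^-1 ^+ n @[n --> \oo] --> (0 : R).
    by apply: cvg_expr; rewrite ger0_norm// invf_lt1// ltr1n.
  move=> /cvgr0_norm_le/(_ _ e0)[N _ /(_ N.+1 (leqnSn _))] /= h.
  by exists N; exact: le_trans (ler_norm _) h.
(* With m = k.+1 * n.+1 differences, 2 * m * |s| / rho is at most kap / 2. *)
pose rho : R := 4 * k.+1%:R / kap.
have rho0 : 0 < rho by rewrite divr_gt0// mulr_gt0.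
set A := (2 * expR (3 * rho ^+ 2) * \int[mu]_x gauss D 2^-1 x).
have A0 : 0 <= A.
  apply: mulr_ge0; first by rewrite mulr_ge0// expR_ge0.
  by apply: Rintegral_ge0 => x _; exact: gauss_ge0.
exists (A * e) => chi n npol.
suff fourier_le : normc (hat chi) <= A * e * e ^+ n by rewrite ger0_norm ?normc_ge0.
have rhs0 : 0 <= A * e * e ^+ n.
  by apply: mulr_ge0; [apply: mulr_ge0 => //; exact: ltW|rewrite exprn_ge0// ltW].
have [x [xb Hx] chix] : exists2 x, box D n.+1%:R^-1 x & 1 / 2 < normc (chi x - 1).
  apply: contrapT => h; apply: npol => x xb; rewrite leNgt; apply/negP => hx.
  by apply: h; exists x.
have [chih|chih] := eqVneq (chi (x - shrink D 1 x)) 1; last first.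
  rewrite (@fourier_gauss_trivial chi (x - shrink D 1 x))//.
  - by rewrite ComplexField.Normc.normc0.
  - by apply: kernel_partB => //; exact: kernel_part_shrink.
  - by move=> j; rewrite crdD crdN crd_shrink mul1r subrr.
have [j hj] : exists j : 'I_(dec_dim D), kap < normc (chi (axis j (crd x j)) - 1).
  apply: contrapT => /forallNP h; move: chix.
  rewrite -{1}(subrK (shrink D 1 x) x) characterD chih [1 * chi _]mul1r shrink1_sum.
  rewrite ltNge => /negP; apply.
  apply: (le_trans (unitary_dist1_sum chi _ (crd x))).
  apply: (@le_trans _ _ (\sum_(j < dec_dim D) kap)).
    by apply: ler_sum => j _; rewrite leNgt; apply/negP/h.
  rewrite sumr_const card_ord -[leLHS]mulr_natr /kap -[(dec_dim D).+1%:R]natr1 [leLHS]mulrC.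
  have d0 : 0 <= (dec_dim D)%:R :> R by [].
  by move: (dec_dim D)%:R d0 => d d0; rewrite ler_pdivrMr; lra.
pose m := (k.+1 * n.+1)%N.
have ms : m%:R * `|crd x j| <= k.+1%:R.
  rewrite /m natrM -mulrA ler_piMr//.
  by rewrite (le_trans (ler_wpM2l _ (xb j)))// mulfV.
have krho : k.+1%:R <= rho.
  rewrite /rho ler_pdivlMr//.
  by rewrite (le_trans (ler_wpM2l _ kap1))// mulr1 ler_peMl// ler1n.
have H := fourier_gauss_axis chi j rho0 (le_trans ms krho).
have H2 : (2 * (m%:R * `|crd x j|) / rho) <= kap / 2.
  rewrite ler_pdivrMr// /rho.
  have -> : kap / 2 * (4 * k.+1%:R / kap) = 2 * k.+1%:R by field; rewrite gt_eqF.
  by rewrite ler_wpM2l.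
have H3 : kap ^+ m * normc (hat chi) <= (kap / 2) ^+ m * A.
  apply: (le_trans (le_trans _ H)).
    by rewrite ler_wpM2r ?normc_ge0// lerXn2r ?nnegrE ?normc_ge0 ?(ltW kap0) ?(ltW hj).
  rewrite ler_wpM2r// lerXn2r// ?nnegrE ?divr_ge0 ?mulr_ge0 ?(ltW rho0) ?(ltW kap0)//.
have {}H3 : normc (hat chi) <= 2^-1 ^+ m * A.
  rewrite -(ler_pM2l (exprn_gt0 m kap0)) mulrA -exprMn.
  exact: H3.
apply: (le_trans H3); rewrite -mulrA -exprS mulrC ler_wpM2l//.
by rewrite /m exprM lerXn2r// ?nnegrE ?exprn_ge0 ?(ltW e0).
Qed.

Lemma gauss_sqr x : gauss D 1 x = gauss D 2^-1 x * gauss D 2^-1 x.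
Proof. by rewrite -gaussD; congr gauss; field. Qed.

Lemma gauss_tail e : 0 < e -> exists n : nat, forall x, ~ box D n.+1%:R x ->
  gauss D 1 x <= e * gauss D 2^-1 x.
Proof.
move=> e0; have h0 : 0 < 2^-1 :> R by rewrite invr_gt0.
have [_ /(_ _ h0)[A HA]] := gauss_fast_decay D h0.
have : A * 2^-1 ^+ n @[n --> \oo] --> A * (0 : R).
  by apply: cvgMr; apply: cvg_expr; rewrite ger0_norm// invf_lt1// ltr1n.
rewrite mulr0 => /cvgr0_norm_le/(_ _ e0)[n _ /(_ n (leqnn n))] /= hn.
exists n => x nx; rewrite gauss_sqr ler_wpM2r ?gauss_ge0//.
apply: (le_trans (ler_norm _)); apply: (le_trans (HA _ _ nx)).
exact: le_trans (ler_norm _) hn.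
Qed.

(** On a large box a nearby character differs little; outside it the Gaussian is
a small multiple of the wider Gaussian, which is still integrable. *)
Lemma gauss_integral_continuous (part : R[i] -> R) :
  (forall z1 z2 : R[i], part (z1 - z2) = part z1 - part z2) ->
  (forall z, `|part z| <= normc z) ->
  continuous (fun chi : character R G => \int[mu]_x (gauss D 1 x * part (chi x))).
Proof.
move=> pB ple chi.
have FF : Filter (nbhs chi) by exact: nbhs_filter.
apply/(@cvgrPdist_le R R (character R G) (nbhs chi) FF) => e e0.
have h0 : 0 < 2^-1 :> R by rewrite invr_gt0.
have ig := gauss_integrable mu_haar ltr01; have ih := gauss_integrable mu_haar h0.
have int_part psi : mu.-integrable [set: borel G]
    (EFin \o ((fun x => gauss D 1 x * part (psi x)) : borel G -> R)).
  apply: integrableM => //.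
    by apply: continuous_borel_fun; exact: character_part_continuous.
  by move=> x; rewrite -(normc_character psi x).
set I := \int[mu]_x gauss D 2^-1 x.
have I0 : 0 <= I by apply: Rintegral_ge0 => x _; exact: gauss_ge0.
pose d := e / (2 * (I + 1)).
have d0 : 0 < d by rewrite divr_gt0// mulr_gt0// ltr_wpDl.
have [n Hn] := gauss_tail d0.
have dC0 : 0 < d%:C%C :> R[i] by rewrite ltcR.
have near_chi := nbhs_character chi (@box_compact R G D n.+1%:R) dC0.
apply: (@filterS _ (nbhs chi) FF _ _ _ near_chi) => psi Hpsi.
rewrite -RintegralB//.
apply: (@le_trans _ _ (\int[mu]_x (2 * d * gauss D 2^-1 x))); last first.
  rewrite RintegralZl// -/I /d.
  have -> : 2 * (e / (2 * (I + 1))) * I = e * (I / (I + 1)).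
    by field; rewrite gt_eqF// ltr_wpDl.
  by rewrite ler_piMr ?(ltW e0)// ler_pdivrMr ?mul1r ?lerDl// ltr_wpDl.
have iB : mu.-integrable [set: borel G]
    (EFin \o ((fun x => gauss D 1 x * part (chi x) - gauss D 1 x * part (psi x))
      : borel G -> R)).
  by have := integrableB measurableT (int_part chi) (int_part psi); apply: eq_integrable.
apply: (le_trans (le_normr_Rintegral _ _)) => //.
apply: le_Rintegral => //.
- exact: integrable_norm.
- by have := integrableZl measurableT (2 * d) ih; apply: eq_integrable.
move=> x _; rewrite -mulrBr -pB normrM ger0_norm ?gauss_ge0//.
have g2 := gauss_ge0 D 2^-1 x.
have [bx|bx] := pselect (box D n.+1%:R x).
  rewrite mulrC; apply: ler_pM; rewrite ?gauss_ge0//.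
    apply: (le_trans (ple _)); have := Hpsi _ bx; rewrite normCE ltcR => /ltW/le_trans; apply.
    by rewrite ler_peMl ?(ltW d0)// ler1n.
  by rewrite gauss_sqr ler_piMl// gauss_le1// ltW.
rewrite -mulrA [2 * _]mulrC; apply: ler_pM; rewrite ?gauss_ge0//; first exact: Hn.
apply: (le_trans (ple _)); apply: (le_trans (le_normc_add _ _)).
have -> : normc (- psi x) = 1 by rewrite -sub0r normc_sub subr0 normc_character.
by rewrite normc_character.
Qed.

End gaussian_fourier.

(** * Translates of the Gaussian and the embedding theorem *)

Section amalgam_comparison.
Context {R : realType} {G : topologicalZmodType} (D : decomposition R G).
Variable mu : {measure set (borel G) -> \bar R}.
Hypothesis mu_haar : normalized_haar D mu.
Implicit Types (x y v : G) (f : G -> R[i]).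

Lemma amalgam_norm1 p f :
  amalgam_norm D mu p 1 f =
  (\esum_(a in @dec_index _ _ D) Lp_norm_on mu p (dec_cell a) f)%E.
Proof.
have L0 a : (0 <= Lp_norm_on mu p (@dec_cell _ _ D a) f)%E by exact: poweR_ge0.
rewrite /amalgam_norm invr1 poweRe1.
  by apply: eq_esum => a _; rewrite poweRe1.
by apply: esum_ge0 => a _; exact: poweR_ge0.
Qed.

Lemma amalgam_norm_ge0 p q f : (0 <= amalgam_norm D mu p q f)%E.
Proof. exact: poweR_ge0. Qed.

Lemma Lp_norm_on_scale p (A : set (borel G)) f g C : 0 < p -> 0 <= C ->
  measurable A -> complex_measurable f -> complex_measurable g ->
  (forall x, modulus g x <= C * modulus f x) ->
  (Lp_norm_on mu p A g <= C%:E * Lp_norm_on mu p A f)%E.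
Proof.
move=> p0 C0 mA mf mg gf; rewrite /Lp_norm_on.
have mod0 h x : 0 <= modulus h x := normc_ge0 (h x).
have int0 h : (0 <= \int[mu]_(x in A) (modulus h x `^ p)%:E)%E.
  by apply: integral_ge0 => x _; rewrite lee_fin powR_ge0.
have -> : C%:E = (((C `^ p)%:E) `^ p^-1)%E.
  by rewrite poweR_EFin -powRrM divff ?gt_eqF// powRr1.
rewrite -poweRM ?lee_fin ?powR_ge0 ?invr_ge0 ?(ltW p0)//.
apply: gt0_ler_poweR.
- by rewrite invr_ge0 ltW.
- by rewrite in_itv /= leey andbT.
- by rewrite in_itv /= leey andbT mule_ge0// lee_fin powR_ge0.
have mp h : complex_measurable h ->
    measurable_fun A (fun x : borel G => (modulus h x `^ p)%:E).
  exact: measurable_modulus_powR.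
rewrite -ge0_integralZl//; last 3 first.
- exact: mp.
- by move=> x _; rewrite lee_fin powR_ge0.
- by rewrite lee_fin powR_ge0.
apply: ge0_le_integral => //.
- by move=> x _; rewrite lee_fin powR_ge0.
- exact: mp.
- by apply: emeasurable_funM => //; exact: mp.
move=> x _; rewrite -EFinM lee_fin -powRM//.
apply: ge0_ler_powR; rewrite ?nnegrE//; first exact: ltW.
- exact: mod0.
- by apply: mulr_ge0 => //; exact: mod0.
Qed.

Lemma amalgam_norm1_scale p f g C : 0 < p -> 0 <= C ->
  complex_measurable f -> complex_measurable g ->
  (forall x, modulus g x <= C * modulus f x) ->
  (amalgam_norm D mu p 1 g <= C%:E * amalgam_norm D mu p 1 f)%E.
Proof.
move=> p0 C0 mf mg gf; rewrite !amalgam_norm1.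
apply: (@le_trans _ _
    (\esum_(a in @dec_index _ _ D) (C%:E * Lp_norm_on mu p (dec_cell a) f))%E).
  by apply: le_esum => a _; apply: Lp_norm_on_scale => //; exact: cell_measurable.
apply: ge_ereal_sup => _ [X [finX XJ] <-].
rewrite -ge0_mule_fsumr; last by move=> a; exact: poweR_ge0.
rewrite lee_wpmul2l ?lee_fin//.
by apply: ereal_sup_ubound; exists X.
Qed.

Lemma amalgam_norm1_ge_cell p f A y : 0 < p -> 0 <= A -> complex_measurable f ->
  (forall x, box D 1 (x - y) -> A <= modulus f x) ->
  (A%:E <= amalgam_norm D mu p 1 f)%E.
Proof.
move=> p0 A0 mf fA; have [a Ja ay] := cell_coverP D y.
rewrite amalgam_norm1; apply: (@le_trans _ _ (Lp_norm_on mu p (@dec_cell _ _ D a) f)).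
  by apply: (Lp_norm_on_cell_ge mu_haar) => // x ax; apply: fA; exact: cell_sub ax ay.
apply: esum_ge; exists [set a]; first by split; [exact: finite_set1|move=> _ ->].
by rewrite fsbig_set1.
Qed.

End amalgam_comparison.

Section translates.
Context {R : realType} {G : topologicalZmodType} (D : decomposition R G).
Variable mu : {measure set (borel G) -> \bar R}.
Hypothesis mu_haar : normalized_haar D mu.
Implicit Types (x y v : G) (chi psi : character R G).

(** The test functions: translates of one Gaussian. *)
Definition gauss_at y x : R[i] := (gauss D 1 (x - y))%:C%C.

Lemma modulus_gauss_at y x : modulus (gauss_at y) x = gauss D 1 (x - y).
Proof. by rewrite /modulus /gauss_at normcR ger0_norm// gauss_ge0. Qed.

Lemma gauss_at_measurable y : complex_measurable (gauss_at y).
Proof.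
split; last exact: measurable_cst.
exact: (measurableT_comp (measurable_gauss D 1) (measurable_translate (- y))).
Qed.

(** Translation only changes the phase of the transform, hence no norm on the
dual side. *)
Lemma fourier_gauss_at y chi : fourier mu (gauss_at y) chi =
  (chi y)^*%C * fourierR mu (gauss D 1) chi.
Proof. exact: (fourierR_translate mu_haar y chi (gauss_integrable mu_haar ltr01)). Qed.

Lemma modulus_fourier_gauss_at y chi :
  modulus (fourier mu (gauss_at y)) chi = normc (fourierR mu (gauss D 1) chi).
Proof.
by rewrite /modulus fourier_gauss_at normcM normc_conj normc_character mul1r.
Qed.

Lemma eval_part_continuous (part : R[i] -> R) y :
  (forall z1 z2 : R[i], part (z1 - z2) = part z1 - part z2) ->
  (forall z, `|part z| <= normc z) ->
  continuous (fun chi : character R G => part (chi y)).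
Proof.
move=> pB ple chi; have FF : Filter (nbhs chi) by exact: nbhs_filter.
apply/(@cvgrPdist_lt R R (character R G) (nbhs chi) FF) => e e0.
have eC0 : 0 < e%:C%C :> R[i] by rewrite ltcR.
have H := nbhs_character chi (@compact_set1 G y) eC0.
apply: (@filterS _ (nbhs chi) FF _ _ _ H) => psi Hpsi.
by rewrite -pB (le_lt_trans (ple _))//; have := Hpsi y erefl; rewrite normCE ltcR.
Qed.

Lemma fourier_gauss_at_measurable y : complex_measurable (fourier mu (gauss_at y)).
Proof.
have ig := gauss_integrable mu_haar ltr01.
pose F (part : R[i] -> R) (chi : character R G) := \int[mu]_x (gauss D 1 x * part (chi x)).
have mF (part : R[i] -> R) : (forall z1 z2 : R[i], part (z1 - z2) = part z1 - part z2) ->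
    (forall z, `|part z| <= normc z) -> measurable_fun [set: borel (character R G)] (F part).
  move=> pB ple; apply: continuous_borel_fun.
  exact: (gauss_integral_continuous mu_haar pB ple).
have mE (part : R[i] -> R) : (forall z1 z2 : R[i], part (z1 - z2) = part z1 - part z2) ->
    (forall z, `|part z| <= normc z) ->
    measurable_fun [set: borel (character R G)]
      (fun chi : borel (character R G) => part (character_fun chi y)).
  by move=> pB ple; apply: continuous_borel_fun; exact: eval_part_continuous.
have mFR := mF _ ReB (@Re_le_normc R); have mFI := mF _ ImB (@Im_le_normc R).
have mER := mE _ ReB (@Re_le_normc R); have mEI := mE _ ImB (@Im_le_normc R).
have E chi : fourier mu (gauss_at y) chi =
    ((complex.Re (chi y) * F (@complex.Re R) chi -
        complex.Im (chi y) * F (@complex.Im R) chi) +i*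
     (- (complex.Re (chi y) * F (@complex.Im R) chi +
        complex.Im (chi y) * F (@complex.Re R) chi)))%C.
  rewrite fourier_gauss_at fourierRE// -/(F (@complex.Re R) chi) -/(F (@complex.Im R) chi).
  by case: (chi y) => a b; apply/eqP; rewrite eq_complex /= mulrNN mulrN mulNr -opprD !eqxx.
split.
- under eq_fun do rewrite E /=.
  by apply: measurable_funB; exact: measurable_funM.
- under eq_fun do rewrite E /=.
  by apply: measurableT_comp => //; apply: measurable_funD; exact: measurable_funM.
Qed.

End translates.

Theorem theorem12 (R : realType) (G : topologicalZmodType)
  (G_hausdorff : hausdorff_space G) (G_lc : locally_compact [set: G])
  (D : decomposition R G) (D' : decomposition R (character R G))
  (mu : {measure set (borel G) -> \bar R})
  (mu' : {measure set (borel (character R G)) -> \bar R})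
  (mu_haar : normalized_haar D mu) (mu'_haar : normalized_haar D' mu')
  (p q r : R) (p_ge1 : 1 <= p) (q_ge1 : 1 <= q) (r_ge1 : 1 <= r)
  (w1 w2 : G -> R) (w : character R G -> R)
  (w1_beurling : beurling_weight mu w1) (w2_beurling : beurling_weight mu w2)
  (w_beurling : beurling_weight mu' w) :
  continuously_embedded
    (A_space D D' mu mu' p q r w1 w) (A_norm D D' mu mu' p q r w1 w)
    (A_space D D' mu mu' p q r w2 w) (A_norm D D' mu mu' p q r w2 w) <->
  weight_dominated w2 w1.
Proof.
have p0 : 0 < p by exact: lt_le_trans p_ge1.
have q0 : 0 < q by exact: lt_le_trans q_ge1.
have r0 : 0 < r by exact: lt_le_trans r_ge1.
have w10 := beurling_ge0 w1_beurling; have w20 := beurling_ge0 w2_beurling.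
have w0 := beurling_ge0 w_beurling.
have mw1 : measurable_fun [set: borel G] (w1 : borel G -> R) by case: w1_beurling.
have mw2 : measurable_fun [set: borel G] (w2 : borel G -> R) by case: w2_beurling.
have mw : measurable_fun [set: borel (character R G)] (w : borel (character R G) -> R).
  by case: w_beurling.
split; last first.
  (* A smaller weight gives a smaller norm; the dual parts coincide. *)
  move=> [C [C0 w21]].
  have norm_le f : complex_measurable f ->
      (weighted_amalgam_norm D mu w2 p 1 f <= C%:E * weighted_amalgam_norm D mu w1 p 1 f)%E.
    move=> mf; apply: amalgam_norm1_scale => //; [exact: ltW|exact: complex_measurableZ..|].
    move=> x; rewrite !modulusZ// mulrCA ler_wpM2l//; exact: normc_ge0.
  split.
    move=> f [[fL f1] fhat]; split; last exact: fhat.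
    split; first exact: fL.
    apply: (le_lt_trans (norm_le f fL.1)).
    by rewrite lte_mul_pinfty// lee_fin ltW.
  exists (C + 1); split; first exact: ltr_wpDr.
  move=> f [[fL _] _]; rewrite /A_norm.
  set N2 := weighted_amalgam_norm D mu w2 p 1 f.
  set N1 := weighted_amalgam_norm D mu w1 p 1 f.
  set Nh := weighted_amalgam_norm D' mu' w q r _.
  have N10 : (0 <= N1)%E by exact: amalgam_norm_ge0.
  have Nh0 : (0 <= Nh)%E by exact: amalgam_norm_ge0.
  rewrite ge0_muleDr//; apply: leeD.
    apply: (le_trans (norm_le f fL.1)); rewrite lee_wpmul2r// lee_fin lerDl//.
  rewrite -[leLHS]mul1e lee_wpmul2r// lee_fin lerDr ltW//.
move=> [_ [c [c0 Hc]]].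
have [B1 B10 HB1] := fast_decay_amalgam mu_haar p0 (lexx 1) (box_exhaustionP D)
  (fast_decay_weight mu_haar (box_exhaustionP D) w1_beurling (gauss_fast_decay D ltr01)).
have hat_decay := fourier_gauss_fast_decay mu_haar.
have [B2 B20 HB2] := fast_decay_amalgam mu'_haar q0 r_ge1 (dual_exhaustionP D)
  (fast_decay_weight mu'_haar (dual_exhaustionP D) w_beurling hat_decay).
have [M M1 HM] := beurling_locally_bounded mu_haar w2_beurling (@box_compact R G D 1).
have M0 : 0 < M by exact: lt_le_trans M1.
(* Submultiplicativity moves the translation of the test function to the weight. *)
have norm1 y : (weighted_amalgam_norm D mu w1 p 1 (gauss_at D y) <= (B1 * w1 y)%:E)%E.
  have := HB1 y (w1 y) (fun x => gauss_at D y x * (w1 x)%:C%C) (w10 y).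
  rewrite invr1 !powRr1 ?mulr_ge0//; apply.
    by apply: complex_measurableZ => //; exact: gauss_at_measurable.
  move=> x; rewrite modulusZ// modulus_gauss_at ger0_norm ?mulr_ge0 ?gauss_ge0//.
  rewrite mulrCA ler_wpM2l ?gauss_ge0//.
  by case: w1_beurling => _ _ _ /(_ y (x - y)); rewrite addrC subrK.
pose B3 := (B2 * 1 `^ r) `^ r^-1.
have B30 : 0 <= B3 by exact: powR_ge0.
have norm_hat y : (weighted_amalgam_norm D' mu' w q r (fourier mu (gauss_at D y)) <= B3%:E)%E.
  apply: (HB2 0) => //.
    by apply: complex_measurableZ => //; exact: (fourier_gauss_at_measurable mu_haar).
  move=> chi; rewrite modulusZ// (modulus_fourier_gauss_at mu_haar) subr0 mul1r.
  by rewrite ger0_norm// mulr_ge0// normc_ge0.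
(* A single cell, the one that contains y, already sees the weight at y. *)
have norm2 y : ((expR (- 1 * (dec_dim D)%:R) * (w2 y / M))%:E <=
    weighted_amalgam_norm D mu w2 p 1 (gauss_at D y))%E.
  apply: (amalgam_norm1_ge_cell mu_haar (y := y)) => //.
  - by rewrite mulr_ge0 ?expR_ge0// divr_ge0// ltW.
  - by apply: complex_measurableZ => //; exact: gauss_at_measurable.
  move=> x xy; rewrite modulusZ// modulus_gauss_at.
  apply: ler_pM; rewrite ?expR_ge0 ?divr_ge0 ?(ltW M0)//.
    exact: gauss_ge_box1.
  rewrite ler_pdivrMr//; case: w2_beurling => _ _ _ /(_ x (y - x)).
  rewrite addrC subrK => /le_trans; apply; rewrite ler_wpM2l// HM//.
  by rewrite -opprB; exact: boxN.
have memA y : A_space D D' mu mu' p q r w1 w (gauss_at D y).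
  split; split.
  - apply: (bounded_Lp_loc mu_haar (A := 1)); [exact: ltW|exact: gauss_at_measurable|].
    by move=> x; rewrite modulus_gauss_at gauss_le1.
  - exact: le_lt_trans (norm1 y) (ltry _).
  - have [A HA] := hat_decay.1.
    apply: (bounded_Lp_loc mu'_haar (A := A)); first exact: ltW.
      exact: (fourier_gauss_at_measurable mu_haar).
    move=> chi; rewrite (modulus_fourier_gauss_at mu_haar).
    exact: le_trans (ler_norm _) (HA chi).
  - exact: le_lt_trans (norm_hat y) (ltry _).
pose E : R := expR (- 1 * (dec_dim D)%:R).
have E0 : 0 < E by exact: expR_gt0.
exists (M / E * (c * (B1 + B3)) + 1); split.
  by rewrite ltr_wpDl// mulr_ge0 ?divr_ge0 ?(ltW M0) ?(ltW E0)// mulr_ge0 ?(ltW c0)// addr_ge0.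
move=> y; have key : (E * (w2 y / M) <= c * (B1 * w1 y + B3)).
  rewrite -lee_fin; apply: (le_trans (norm2 y)).
  apply: (@le_trans _ _ (A_norm D D' mu mu' p q r w2 w (gauss_at D y))).
    by rewrite /A_norm leeDl//; exact: amalgam_norm_ge0.
  apply: (le_trans (Hc _ (memA y))); rewrite EFinM lee_wpmul2l ?lee_fin ?(ltW c0)//.
  by rewrite /A_norm EFinD leeD.
have w11 : 1 <= w1 y by case: w1_beurling.
have {}key : w2 y <= M / E * (c * (B1 * w1 y + B3)).
  rewrite -(ler_pM2l (divr_gt0 E0 M0)).
  have -> : E / M * (M / E * (c * (B1 * w1 y + B3))) = c * (B1 * w1 y + B3).
    by field; rewrite !gt_eqF.
  by rewrite mulrAC -mulrA.
have le_w1 : B1 * w1 y + B3 <= (B1 + B3) * w1 y by rewrite mulrDl lerD2l ler_peMr.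
have ME0 : 0 <= M / E by rewrite divr_ge0 ?(ltW M0) ?(ltW E0).
apply: (le_trans key); apply: (le_trans (ler_wpM2l ME0 (ler_wpM2l (ltW c0) le_w1))).
by rewrite [leRHS]mulrDl mul1r !mulrA lerDl.
Qed.
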